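(* Let $q\in\widetilde{\mathbb C}$, and let $u$ be the symmetrical form such that $\sigma u=\mathcal U^{(\alpha)}(b,q)$. Then $u$ is an $H_{\sqrt q}$-semiclassical form of class one for $b\neq0$, $b\neq q^{n+1+\alpha}$, $n\ge0$, $\alpha\in\mathbb R$, satisfying $$H_{\sqrt q}(xu)+q^{-\alpha-1}\big(q^{\frac12}-1\big)^{-1}\big\{x^2+b-q^{\alpha+1}\big\}u=0.$$ Moreover: (i) $(u)_{2n}=(-b)^n\big(b^{-1}q^{\alpha+1};q\big)_n$ and $(u)_{2n+1}=0$, $n\ge0$. (ii) If $\alpha\in\mathbb R$, $q>1$, $0<b<q^{\alpha+1}$, then for every $f\in\mathcal P$ $$\langle u,f\rangle=K\int_{-\infty}^\infty\frac{|x|^{2\alpha-2\frac{\ln b}{\ln q}+1}}{(-b^{-1}x^2;q^{-1})_\infty}f(x)\,dx,\qquad K^{-1}=\int_0^\infty\frac{x^{\alpha-\frac{\ln b}{\ln q}}}{(-b^{-1}x;q^{-1})_\infty}\,dx ,$$ where $K^{-1}$ is given by the integral formula recalled in the context. (iii) If $\alpha\in\mathbb R$, $q>1$, $b<0$, then $$u=\frac{1}{(b^{-1}q^\alpha;q^{-1})_\infty}\sum_{k=0}^\infty\frac{q^{-\frac12k(k-1)}}{(q^{-1};q^{-1})_k}(-b^{-1}q^\alpha)^k\,\frac{\delta_{\sqrt{-b}\,q^{k/2}}+\delta_{-\sqrt{-b}\,q^{k/2}}}{2}.$$ (iv) If $\alpha\in\mathbb R$, $0<q<1$, $b>q^{\alpha+1}$,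 then $$u=\big(b^{-1}q^{\alpha+1};q\big)_\infty\sum_{k=0}^\infty\frac{(b^{-1}q^{\alpha+1})^k}{(q;q)_k}\,\frac{\delta_{i\sqrt b\,q^{k/2}}+\delta_{-i\sqrt b\,q^{k/2}}}{2}.$$
   Context: $\mathcal P$ is the vector space of polynomials in one variable with complex coefficients and $\mathcal P'$ its dual; elements of $\mathcal P'$ are called forms; $\langle u,f\rangle$ is the action of $u$ on $f$ and $(u)_n=\langle u,x^n\rangle$ are the moments. All regular forms are normalized by $(u)_0=1$. A form is symmetrical if $(u)_{2n+1}=0$ for all $n\ge0$. Let $\widetilde{\mathbb C}=\{z\in\mathbb C: z\neq0,\ z^n\neq1\ \forall n\ge1\}$; square roots and real powers of complex numbers are taken with the principal branch of the logarithm. $(a;q)_0=1$, $(a;q)_n=\prod_{k=1}^n(1-aq^{k-1})$, and $(a;q)_\infty=\prod_{k\ge0}(1-aq^k)$ for $|q|<1$. $\delta_c$ is the form $\langle\delta_c,f\rangle=f(c)$. Integral formula: for $0<p<1$, $y>0$ and $|a|<p^{y}$, the integral $\int_0^\infty t^{y-1}\frac{(-at;p)_\infty}{(-t;p)_\infty}\,dt$ equals $\frac{\pi}{\sin(\pi y)}\frac{(a;p)_\infty}{(ap^{-y};p)_\infty}\frac{(p^{1-y};p)_\infty}{(p;p)_\infty}$ if $y\notin\mathbb N$, and equals $\frac{(-p)^m}{1-p^m}\frac{(p^{-1};p^{-1})_m}{(ap^{-1};p^{-1})_m}\ln(p^{-1})$ if $y=m$ is a positive integer. (For $K^{-1}$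 it is used with $p=q^{-1}$ and $a=0$, after rescaling the variable by $b$.) For a polynomial $g$, $\langle gu,f\rangle=\langle u,gf\rangle$. For $r\in\widetilde{\mathbb C}$, $(H_rf)(x)=\frac{f(rx)-f(x)}{(r-1)x}$ and $\langle H_ru,f\rangle=-\langle u,H_rf\rangle$. The form $\sigma u$ is defined by $\langle\sigma u,f\rangle=\langle u,f(x^2)\rangle$. A form $u$ is regular if there is a sequence of monic polynomials $\{B_n\}_{n\ge0}$, $\deg B_n=n$, with $\langle u,B_mB_n\rangle=r_n\delta_{n,m}$, $r_n\ne0$. A form $u$ is $H_r$-semiclassical if it is regular and $H_r(\Phi u)+\Psi u=0$ for some polynomials $\Phi$ (monic, degree $t\ge0$) and $\Psi$ (degree $p\ge1$). It is of class $s=\max(p-1,t-2)$ if and only if the pair $(\Phi,\Psi)$ satisfies $$\prod_{c\in\mathcal Z_\Phi}\Big\{\big|r\Psi(rc)+(H_r\Phi)(c)\big|+\big|\langle u,\ r(\theta_{cr}\Psi)+\theta_{cr}(\theta_c\Phi)\rangle\big|\Big\}>0,$$ where $\mathcal Z_\Phi$ is the set of zeros of $\Phi$ and $(\theta_cf)(x)=\frac{f(x)-f(c)}{x-c}$. $\mathcal U^{(\alpha)}(b,q)$ (the generalized $q^{-1}$-Laguerre form, $b\neq0$, $b\neq q^{n+1+\alpha}$, $n\ge0$) is the form with $(\mathcal U^{(\alpha)}(b,q))_0=1$ satisfying $H_q(x\,\mathcal U^{(\alpha)}(b,q))+(q-1)^{-1}q^{-\alpha-1}(x+b-q^{\alpha+1})\,\mathcal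 U^{(\alpha)}(b,q)=0$.
   Formalization: The claim ''of class one'' is stated only for b ≠ q^{α+1/2}: at b = q^{α+1/2} the class criterion fails at c = 0, u satisfies H_{√q}(u) + (b(√q−1))^{-1} x u = 0 and has class zero; all other claims are unrestricted. *)

(* Defs.v *)
(* The complex numbers are R[i] over R : realType. *)
From HB Require Import structures.
From mathcomp Require Import all_boot all_order all_algebra.
From mathcomp Require Import all_classical all_reals all_analysis.
From mathcomp Require Import complex.

Set Implicit Arguments.
Unset Strict Implicit.
Unset Printing Implicit Defensive.

Import Order.TTheory GRing.Theory Num.Theory.
Import numFieldNormedType.Exports.

Local Open Scope classical_set_scope.
Local Open Scope ring_scope.
Local Open Scope complex_scope.

Section ComplexPowers.
Variable R : realType.
Implicit Types z w : R[i].

(* The modulus is taken in R; `|z| lives in R[i]. *)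
Definition cmod z : R := complex.Re `|z|.

Definition cexp z : R[i] :=
  (expR (complex.Re z))%:C * (cos (complex.Im z) +i* sin (complex.Im z)).

(* Principal argument, in ]-pi, pi], for z != 0. *)
Definition carg z : R :=
  if 0 <= complex.Im z then acos (complex.Re z / cmod z)
  else - acos (complex.Re z / cmod z).

Definition clog z : R[i] := ln (cmod z) +i* carg z.

Definition cpow z (a : R) : R[i] := cexp (a%:C * clog z).

Definition csqrt z : R[i] := cpow z 2^-1.

Definition Ctilde z : Prop := z <> 0 /\ forall n : nat, (1 <= n)%N -> z ^+ n <> 1.

End ComplexPowers.

Section QPochhammer.

Definition qpoch (K : nzRingType) (a q : K) (n : nat) : K :=
  \prod_(1 <= k < n.+1) (1 - a * q ^+ k.-1).

Definition qpoch_inf (R : realType) (a q : R) : R :=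
  limn (fun n => \prod_(0 <= k < n) (1 - a * q ^+ k)).

(* Closed form of the integral of
     t ^ (y - 1) * (- a t; p)_oo / (- t; p)_oo   over ]0, +oo[,
   for 0 < p < 1, 0 < y and `|a| < p ^ y. *)
Definition qgamma_integral_value (R : realType) (p a y : R) : R :=
  if y \is a Num.nat then
    let m := Num.truncn y in
    (- p) ^+ m / (1 - p ^+ m) * (qpoch p^-1 p^-1 m / qpoch (a * p^-1) p^-1 m)
      * ln p^-1
  else
    pi / sin (pi * y) * (qpoch_inf a p / qpoch_inf (a * p `^ (- y)) p)
      * (qpoch_inf (p `^ (1 - y)) p / qpoch_inf p p).

End QPochhammer.

(* R[i] has the topology of its norm as a numFieldType, but its carrier is not
   directly declared to be a topological type; hence the generic K. *)
Definition seq_cvg_to (K : numFieldType) (z : nat -> K) (l : K) : Prop :=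
  z @ \oo --> l.

Section Forms.
Variable R : realType.
Local Notation C := R[i].
Implicit Types (f g Phi Psi : {poly C}) (u : {poly C} -> C).

Definition moment u (n : nat) : C := u 'X^n.

Definition mulform g u : {poly C} -> C := fun f => u (g * f).

Definition symmetrical u : Prop := forall n : nat, moment u n.*2.+1 = 0.

Definition sigma_form u : {poly C} -> C := fun f => u (f \Po 'X^2).

(* The Euclidean quotients in the next two definitions are exact. *)
Definition Hop (r : C) f : {poly C} :=
  (f \Po (r *: 'X) - f) %/ ((r - 1) *: 'X).

Definition theta (c : C) f : {poly C} := (f - f.[c]%:P) %/ ('X - c%:P).

Definition Hform (r : C) u : {poly C} -> C := fun f => - u (Hop r f).

Definition regular_form u : Prop :=
  exists (B : nat -> {poly C}) (rho : nat -> C),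
    [/\ forall n, B n \is monic,
        forall n, size (B n) = n.+1,
        forall n, rho n <> 0
      & forall m n, u (B m * B n) = rho n * (n == m)%:R].

Definition Pearson_eq (r : C) u Phi Psi : Prop :=
  forall f, Hform r (mulform Phi u) f + mulform Psi u f = 0.

Definition semiclassical_pair (r : C) u Phi Psi : Prop :=
  [/\ regular_form u, Phi \is monic, (2 <= size Psi)%N & Pearson_eq r u Phi Psi].

Definition zeros Phi : seq C := undup (sval (closed_field_poly_normal Phi)).

Definition class_criterion (r : C) u Phi Psi : Prop :=
  0 < \prod_(c <- zeros Phi)
        (`|r * Psi.[r * c] + (Hop r Phi).[c]|
         + `|u (r *: theta (c * r) Psi + theta (c * r) (theta c Phi))|).

(* Since deg f = (size f).-1, this is s = max (deg Psi - 1, deg Phi - 2);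
   truncated subtraction is harmless because deg Psi >= 1. *)
Definition semiclassical_of_class (r : C) u (s : nat) : Prop :=
  exists Phi Psi,
    [/\ semiclassical_pair r u Phi Psi,
        s = maxn ((size Psi).-1 - 1) ((size Phi).-1 - 2)
      & class_criterion r u Phi Psi].

(* v is the generalized q^-1-Laguerre form of parameters alpha, b, q; the
   conditions below determine all its moments. *)
Definition is_qinv_Laguerre (alpha : R) (b q : C) (v : {scalar {poly C}}) : Prop :=
  moment v 0 = 1 /\
  Pearson_eq q v 'X
    ((q - 1)^-1 * cpow q (- alpha - 1) *: ('X + (b - cpow q (alpha + 1))%:P)).

Definition dirac_form (c : C) : {poly C} -> C := fun f => f.[c].

Definition scale_form (c : C) u : {poly C} -> C := fun f => c * u f.

Definition add_form u1 u2 : {poly C} -> C := fun f => u1 f + u2 f.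

(* v is the sum of the series of forms phi k, for pointwise convergence. *)
Definition form_series (phi : nat -> {poly C} -> C) (v : {poly C} -> C) : Prop :=
  forall f, seq_cvg_to (fun n => \sum_(0 <= k < n) phi k f) (v f).

(* For a real weight w, integrability and integral of w(x) f(x) over the real
   line, computed on real and imaginary parts. *)
Definition weighted_integrable (w : R -> R) f : Prop :=
  (@lebesgue_measure R).-integrable setT
      (EFin \o (fun x : R => w x * complex.Re f.[x%:C])) /\
  (@lebesgue_measure R).-integrable setT
      (EFin \o (fun x : R => w x * complex.Im f.[x%:C])).

Definition weighted_integral (w : R -> R) f : C :=
  Rintegral lebesgue_measure setT (fun x : R => w x * complex.Re f.[x%:C])
  +i* Rintegral lebesgue_measure setT (fun x : R => w x * complex.Im f.[x%:C]).

End Forms.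

(* Main.v *)
Require Import Defs.
From HB Require Import structures.
From mathcomp Require Import all_boot all_order all_algebra.
From mathcomp Require Import all_classical all_reals all_analysis.
From mathcomp Require Import measurable_realfun.
From mathcomp Require Import complex ring lra.

Set Implicit Arguments.
Unset Strict Implicit.
Unset Printing Implicit Defensive.

Import Order.TTheory GRing.Theory Num.Theory.
Import numFieldNormedType.Exports.

Local Open Scope classical_set_scope.
Local Open Scope ring_scope.

(** For Phi = x a Pearson equation is equivalent to a recurrence for the moments
    (Pearson_eqX_moments).  That of the generalized 1/q-Laguerre form v reads
    v_(n+1) = (q ^ (alpha+1+n) - b) v_n, which gives the moments of u; since
    (sqrt q) ^ (2n) = q ^ n, it is also the recurrence equivalent to the equation
    of u.

    Regularity.  Put a = q ^ (alpha+1) / b, so that v_n = (- b) ^ n (a; q)_n.  Heine's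
    continued fraction for the series with coefficients (a; q)_n suggests the
    recurrence coefficients of the orthogonal polynomials of u.  For the
    polynomials B_n that these coefficients define, <u, x ^ k B_n> has a closed
    product form, which vanishes for k < n and not for k = n
    (regular_symmetric).  The only zero of Phi is 0, where the class criterion is
    the modulus of a number that is nonzero unless b = q ^ (alpha + 1/2).

    Discrete representations.  The moment of order 2n of the series of Dirac
    forms is one of Euler's two series, evaluated at a point proportional to q ^ n
    (cvg_euler_psum, cvg_euler2_psum).  It is therefore an infinite product or
    the inverse of one, and its quotient by its value for n = 0 is the finite
    product of the moments.

    Integral representation.  Let p = 1/q and e(t) = 1 / (- t; p)_oo.  The moments of
    the weight are, after the substitution t = x ^ 2 / b and up to powers of b,
    values M(y + n) of the Mellin transform M of e.  The functional equation
    e(p t) = (1 + t) e(t) gives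
    M(y + 1) = (p ^ (- y) - 1) M(y), which is again the recurrence of the v_n.  It also
    reduces the evaluation of M to 0 < y <= 1 (mellin_qexp).

    For such y, let M_n be the Mellin transform of 1 / (- t; p)_n.  Combining the
    products deprived of their first and of their last factor gives
    (1 - p ^ n) M_(n+1)(y) = (1 - p ^ (n - y)) M_n(y), and M is the limit of M_n by
    dominated convergence.  For y = 1 this starts from an elementary integral
    (mellin_qexp_trunc2).  For y < 1 it starts from the integral of
    t ^ (y-1) / (1 + t), which is pi / sin (pi y) (mellin_cauchy).

    That last formula is proved by a trick of Herglotz.  Both of its sides f
    satisfy 3 f(y) = f(y/3) - f((y+1)/3) + f((y+2)/3), and both are the sum of
    1/y + 1/(1-y) and of bounded monotone functions.  By iteration 3 ^ m times
    their difference at y is an alternating sum of 3 ^ m of its values, which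
    remains bounded as m grows; hence the difference is zero
    (trisection_eq0). *)

(** * q-shifted factorials *)

Section QPochFinite.
Variable K : fieldType.
Implicit Types a q : K.

Lemma qpochE a q n : qpoch a q n = \prod_(0 <= k < n) (1 - a * q ^+ k).
Proof. by rewrite /qpoch big_add1. Qed.

Lemma qpoch0 a q : qpoch a q 0 = 1.
Proof. by rewrite qpochE big_nil. Qed.

Lemma qpochS a q n : qpoch a q n.+1 = qpoch a q n * (1 - a * q ^+ n).
Proof. by rewrite !qpochE big_nat_recr. Qed.

Lemma qpochSl a q n : qpoch a q n.+1 = (1 - a) * qpoch (a * q) q n.
Proof.
rewrite !qpochE big_nat_recl// expr0 mulr1; congr (_ * _).
by apply: eq_bigr => k _; rewrite exprS mulrA.
Qed.

(** Reversing the factors exchanges q and 1 / q. *)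
Lemma qpoch_rev a q n : q != 0 ->
  qpoch (a * q ^+ n) q^-1 n = qpoch (a * q) q n.
Proof.
move=> q0; elim: n => [|n IH]; first by rewrite !qpoch0.
rewrite qpochSl qpochS exprSr mulrA mulfK// IH mulrC.
by rewrite [a * q ^+ n * q]mulrAC.
Qed.

End QPochFinite.

Section QPochLimit.
Variables (R : realType) (p : R).
Hypotheses (p0 : 0 < p) (p1 : p < 1).
Implicit Types (a x : R) (n N : nat).

Lemma qpoch_infE a : qpoch_inf a p = limn (qpoch a p).
Proof.
rewrite /qpoch_inf; suff -> : qpoch a p = fun n => \prod_(0 <= k < n) (1 - a * p ^+ k) by [].
by apply/funext => n; rewrite qpochE.
Qed.

Lemma qpoch_le0_ge1 a n : a <= 0 -> 1 <= qpoch a p n.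
Proof.
move=> a0; elim: n => [|n IH]; first by rewrite qpoch0.
rewrite qpochS mulr_ege1// lerDl -mulNr mulr_ge0 ?oppr_ge0//.
by rewrite exprn_ge0// ltW.
Qed.

(** The elementary inequality 1 + x <= exp x bounds the product by the
    exponential of a geometric series. *)
Lemma qpoch_le0_bound a n : a <= 0 -> qpoch a p n <= expR (- a / (1 - p)).
Proof.
move=> a0; apply: (@le_trans _ _ (expR (- a * \sum_(0 <= k < n) p ^+ k))).
  elim: n => [|n IH]; first by rewrite qpoch0 big_nil mulr0 expR0.
  rewrite qpochS big_nat_recr//= [in leRHS]mulrDr expRD ler_pM//.
  - exact: le_trans ler01 (qpoch_le0_ge1 _ a0).
  - by rewrite addr_ge0// -mulNr mulr_ge0 ?oppr_ge0// exprn_ge0// ltW.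
  - by rewrite -mulNr expR_ge1Dx.
rewrite ler_expR ler_wpM2l ?oppr_ge0//.
rewrite -[leRHS]mul1r ler_pdivlMr ?subr_gt0//.
suff -> : (\sum_(0 <= k < n) p ^+ k) * (1 - p) = 1 - p ^+ n.
  by rewrite gerBl exprn_ge0// ltW.
elim: n => [|n IH]; first by rewrite big_nil expr0 mul0r subrr.
by rewrite big_nat_recr//= mulrDl IH exprS; ring.
Qed.

Lemma cvg_qpoch_shift a l : qpoch (a * p) p @ \oo --> l ->
  qpoch a p @ \oo --> (1 - a) * l.
Proof.
move=> h; rewrite -cvg_shiftS/=.
under eq_fun do rewrite qpochSl.
by apply: cvgM => //; exact: cvg_cst.
Qed.

Lemma qpoch_ge0 a n : a <= 1 -> 0 <= qpoch a p n.
Proof.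
move=> a1; rewrite qpochE prodr_ge0// => k _.
have [a0|a0] := leP 0 a.
  by rewrite subr_ge0 mulr_ile1// ?exprn_ge0 ?exprn_ile1// ltW.
by rewrite addr_ge0// -mulNr mulr_ge0 ?exprn_ge0// ltW// oppr_gt0.
Qed.

(** For a < 1 the partial products are monotone; in general finitely many
    factors are split off until the parameter a p ^ N is below 1. *)
Lemma is_cvg_qpoch a : cvgn (qpoch a p).
Proof.
have [N] : exists N, a * p ^+ N < 1.
  have [a0|a0] := ltP 0 a; last by exists 0%N; rewrite expr0 mulr1 (le_lt_trans a0).
  have /cvgrPdist_lt/(_ a^-1) : (fun n => p ^+ n) @ \oo --> (0 : R).
    by apply: cvg_expr; rewrite gtr0_norm.
  rewrite invr_gt0 => /(_ a0)[N _ /(_ N)] /= /(_ (leqnn _)).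
  rewrite sub0r normrN ger0_norm ?exprn_ge0 ?(ltW p0)// => h.
  by exists N; rewrite mulrC -ltr_pdivlMr// mul1r.
elim: N a => [a|N IH a].
  rewrite expr0 mulr1 => a1; have [a0|a0] := leP a 0.
    apply: nondecreasing_is_cvgn.
      apply/nondecreasing_seqP => n; rewrite qpochS ler_peMr//.
        exact: le_trans ler01 (qpoch_le0_ge1 _ a0).
      by rewrite lerDl -mulNr mulr_ge0 ?oppr_ge0 ?exprn_ge0// ltW.
    exists (expR (- a / (1 - p))) => _ [n _ <-]; exact: qpoch_le0_bound.
  apply: nonincreasing_is_cvgn.
    apply/nonincreasing_seqP => n; rewrite qpochS ler_piMr ?qpoch_ge0 ?(ltW a1)//.
    by rewrite gerBl mulr_ge0 ?exprn_ge0// ltW.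
  by exists 0 => _ [n _ <-]; rewrite qpoch_ge0// ltW.
rewrite exprS mulrA => /IH/cvg_ex[l hl]; apply/cvg_ex; exists ((1 - a) * l).
exact: cvg_qpoch_shift.
Qed.

Lemma cvg_qpoch a : qpoch a p @ \oo --> qpoch_inf a p.
Proof. by rewrite qpoch_infE; exact: is_cvg_qpoch. Qed.

(** In the discrete representations, the infinite products on the two sides or
    their inverses give the moments of order 0 and 2 n, and the finite product
    their quotient. *)
Lemma qpoch_inf_shift a n :
  qpoch_inf a p = qpoch a p n * qpoch_inf (a * p ^+ n) p.
Proof.
elim: n a => [|n IH] a; first by rewrite qpoch0 expr0 mul1r mulr1.
have -> : qpoch_inf a p = (1 - a) * qpoch_inf (a * p) p.
  rewrite qpoch_infE; apply: cvg_lim => //.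
  by apply: cvg_qpoch_shift; exact: cvg_qpoch.
by rewrite IH qpochSl mulrA exprS mulrA.
Qed.

Lemma qpoch_inf_ge1 a : a <= 0 -> 1 <= qpoch_inf a p.
Proof.
move=> a0; rewrite qpoch_infE; apply: limr_ge; first exact: is_cvg_qpoch.
by near=> n; exact: qpoch_le0_ge1.
Unshelve. all: by end_near. Qed.

Lemma qpoch_gt0 a n : a < 1 -> 0 < qpoch a p n.
Proof.
move=> a1; rewrite qpochE prodr_gt0// => k _; rewrite subr_gt0.
have [a0|a0] := leP 0 a; last first.
  by rewrite (le_lt_trans _ ltr01)// mulr_le0_ge0 ?exprn_ge0// ltW.
by rewrite (le_lt_trans _ a1)// ler_piMr// exprn_ile1// ltW.
Qed.

(** Writing 1 / (1 - x) = 1 + x / (1 - x) bounds the reciprocals of the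
    partial products by partial products with a negative parameter. *)
Lemma qpoch_inf_gt0 a : a < 1 -> 0 < qpoch_inf a p.
Proof.
move=> a1; have [a0|a0] := leP a 0.
  exact: lt_le_trans ltr01 (qpoch_inf_ge1 a0).
have b0 : - (a / (1 - a)) <= 0.
  by rewrite oppr_le0 divr_ge0 ?subr_ge0 ?(ltW a0) ?(ltW a1).
apply: (@lt_le_trans _ _ (expR (- - (a / (1 - a)) / (1 - p)))^-1).
  by rewrite invr_gt0 expR_gt0.
rewrite qpoch_infE; apply: limr_ge; first exact: is_cvg_qpoch.
near=> n; rewrite -[leRHS]invrK lef_pV2 ?posrE ?expR_gt0 ?invr_gt0 ?qpoch_gt0//.
apply: le_trans (qpoch_le0_bound n b0).
rewrite !qpochE -prodfV; apply: ler_prod => k _.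
have pk0 : 0 < p ^+ k by rewrite exprn_gt0.
have pk1 : p ^+ k <= 1 by rewrite exprn_ile1// ltW.
have apk : a * p ^+ k <= a by rewrite ler_piMr// ltW.
have apk1 : 0 < 1 - a * p ^+ k by rewrite subr_gt0 (le_lt_trans apk).
rewrite invr_ge0 (ltW apk1)/= -div1r ler_pdivrMr// mulNr opprK.
have s0 : 0 < 1 - a by rewrite subr_gt0.
rewrite -subr_ge0.
have -> : (1 + a / (1 - a) * p ^+ k) * (1 - a * p ^+ k) - 1 =
   (1 - a)^-1 * (a * p ^+ k) * (a - a * p ^+ k).
  by field; rewrite gt_eqF.
by rewrite !mulr_ge0 ?invr_ge0 ?subr_ge0// ltW.
Unshelve. all: by end_near. Qed.

End QPochLimit.

(** * Euler's two series *)

Section LimitComparison.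
Variable R : realType.
Implicit Types (u v : nat -> R) (l c : R).

Lemma cvg_le_cst u l c N : u @ \oo --> l ->
  (forall n, (N <= n)%N -> u n <= c) -> l <= c.
Proof.
move=> ul uc; rewrite -(cvg_lim _ ul)//; apply: limr_le.
  by apply/cvg_ex; exists l.
by near=> n; apply: uc; near: n; exact: nbhs_infty_ge.
Unshelve. all: by end_near. Qed.

Lemma cvg_ge_cst u l c N : u @ \oo --> l ->
  (forall n, (N <= n)%N -> c <= u n) -> c <= l.
Proof.
move=> ul uc; rewrite -(cvg_lim _ ul)//; apply: limr_ge.
  by apply/cvg_ex; exists l.
by near=> n; apply: uc; near: n; exact: nbhs_infty_ge.
Unshelve. all: by end_near. Qed.

End LimitComparison.

Section EulerSeries.
Variables (R : realType) (p : R).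
Hypotheses (p0 : 0 < p) (p1 : p < 1).
Implicit Types (a x : R) (m n N : nat).

(** Used for partial sums of power series, at the points x p ^ N. *)
Lemma cvg_psum0 (c z : nat -> R) m : z @ \oo --> (0 : R) ->
  (fun N => \sum_(0 <= k < m.+1) c k * z N ^+ k) @ \oo --> c 0.
Proof.
move=> z0; elim: m c => [|m IH] c.
  under eq_fun do rewrite big_nat1 expr0 mulr1.
  exact: cvg_cst.
under eq_fun => N.
  rewrite big_nat_recl// expr0 mulr1.
  under eq_bigr do rewrite exprS mulrCA.
  rewrite -mulr_sumr.
over.
suff : (fun N => c 0 + z N * \sum_(0 <= k < m.+1) c k.+1 * z N ^+ k) @ \oo -->
    c 0 + 0 * c 1 by rewrite mul0r addr0.
apply: cvgD; first exact: cvg_cst.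
exact: cvgM z0 (IH (fun k => c k.+1)).
Qed.

Lemma cvg_expM x : (fun N => x * p ^+ N) @ \oo --> (0 : R).
Proof.
rewrite -(mulr0 x); apply: cvgM; first exact: cvg_cst.
by apply: cvg_expr; rewrite gtr0_norm.
Qed.

Definition euler_psum a m : R := \sum_(0 <= k < m) (qpoch p p k)^-1 * a ^+ k.

Definition euler2_psum x m : R :=
  \sum_(0 <= k < m) (p ^+ 'C(k, 2) / qpoch p p k) * x ^+ k.

Lemma euler_psumS a m :
  euler_psum a m.+1 - euler_psum (a * p) m.+1 = a * euler_psum a m.
Proof.
rewrite /euler_psum !big_nat_recl// !expr0 opprD addrACA subrr add0r.
rewrite -sumrB mulr_sumr; apply: eq_bigr => k _.
rewrite qpochS exprMn -exprS [a ^+ k.+1]exprS.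
have h1 : qpoch p p k != 0 by rewrite gt_eqF ?qpoch_gt0.
have h2 : 1 - p ^+ k.+1 != 0 by rewrite gt_eqF// subr_gt0 exprn_ilt1// ltW.
move: h2; set P := p ^+ k.+1 => h2.
by field; rewrite h1 h2.
Qed.

Lemma euler2_psumS x m :
  euler2_psum x m.+1 - euler2_psum (x * p) m.+1 = x * euler2_psum (x * p) m.
Proof.
rewrite /euler2_psum !big_nat_recl// !expr0 opprD addrACA subrr add0r.
rewrite -sumrB mulr_sumr; apply: eq_bigr => k _.
rewrite qpochS !exprMn -exprS [x ^+ k.+1]exprS binS bin1 exprD.
have h1 : qpoch p p k != 0 by rewrite gt_eqF ?qpoch_gt0.
have h2 : 1 - p ^+ k.+1 != 0 by rewrite gt_eqF// subr_gt0 exprn_ilt1// ltW.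
move: h2; set P := p ^+ k.+1 => h2.
by field; rewrite h1 h2.
Qed.

Lemma euler_psum_nd a : 0 <= a -> nondecreasing_seq (euler_psum a).
Proof.
move=> a0; apply/nondecreasing_seqP => m; rewrite /euler_psum big_nat_recr//=.
by rewrite lerDl mulr_ge0 ?exprn_ge0// invr_ge0 ltW// qpoch_gt0.
Qed.

Lemma euler2_psum_nd x : 0 <= x -> nondecreasing_seq (euler2_psum x).
Proof.
move=> x0; apply/nondecreasing_seqP => m; rewrite /euler2_psum big_nat_recr//=.
by rewrite lerDl mulr_ge0 ?exprn_ge0// divr_ge0 ?exprn_ge0// ltW// qpoch_gt0.
Qed.

Lemma euler_psum1 a : euler_psum a 1 = 1.
Proof. by rewrite /euler_psum big_nat1 qpoch0 invr1 mul1r expr0. Qed.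

Lemma euler2_psum1 a : euler2_psum a 1 = 1.
Proof. by rewrite /euler2_psum big_nat1 qpoch0 bin0n /= ?expr0 divr1 mul1r. Qed.

(** Euler's first identity.  The series satisfies E(p a) = (1 - a) E(a), hence
    E(p ^ N a) = (a; p)_N E(a).  This relation holds with an inequality for
    partial sums, which are polynomials equal to 1 at 0: letting N grow bounds
    them, and the limit is pinched. *)
Lemma cvg_euler_psum a : 0 <= a < 1 ->
  euler_psum a @ \oo --> (qpoch_inf a p)^-1.
Proof.
move=> /andP[a0 a1].
have stab (b : R) : 0 <= b < 1 -> 0 <= b * p < 1.
  move=> /andP[b0 b1]; rewrite mulr_ge0// ?(ltW p0)//=.
  by rewrite (le_lt_trans _ b1)// ler_piMr// ltW.
have up (b : R) m N : 0 <= b < 1 ->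
    qpoch b p N * euler_psum b m.+1 <= euler_psum (b * p ^+ N) m.+1.
  elim: N b => [|N IH] b b01; first by rewrite qpoch0 mul1r expr0 mulr1.
  have /andP[b0 b1] := b01.
  have h : (1 - b) * euler_psum b m.+1 <= euler_psum (b * p) m.+1.
    rewrite mulrBl mul1r lerBlDr -lerBlDl euler_psumS ler_wpM2l//.
    exact: (euler_psum_nd b0 (leqnSn m)).
  have -> : qpoch b p N.+1 * euler_psum b m.+1 =
      qpoch (b * p) p N * ((1 - b) * euler_psum b m.+1) by rewrite qpochSl; ring.
  rewrite exprS [b * (p * _)]mulrA.
  apply: le_trans (IH _ (stab _ b01)).
  apply: ler_wpM2l h; apply: qpoch_ge0 => //.
  by have /andP[_ /ltW] := stab _ b01.
have bnd (b : R) m : 0 <= b < 1 -> qpoch_inf b p * euler_psum b m.+1 <= 1.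
  move=> b01; have h1 : (fun N => qpoch b p N * euler_psum b m.+1) @ \oo -->
      qpoch_inf b p * euler_psum b m.+1.
    by apply: cvgM; [exact: cvg_qpoch|exact: cvg_cst].
  have h2 : (fun N => euler_psum (b * p ^+ N) m.+1) @ \oo --> (1 : R).
    have := @cvg_psum0 (fun k => (qpoch p p k)^-1) _ m (cvg_expM b).
    by rewrite qpoch0 invr1.
  apply: (ler_cvg_to h1 h2); near=> N; exact: up.
have cv (b : R) : 0 <= b < 1 -> exists l : R, euler_psum b @ \oo --> l.
  move=> b01; have /andP[b0 b1] := b01.
  suff h : cvgn (euler_psum b) by exists (limn (euler_psum b)).
  apply: nondecreasing_is_cvgn (euler_psum_nd b0) _.
  exists (qpoch_inf b p)^-1 => _ [m _ <-].
  apply: (@le_trans _ _ (euler_psum b m.+1)).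
    exact: (euler_psum_nd b0 (leqnSn m)).
  by rewrite -[leRHS]mul1r ler_pdivlMr ?qpoch_inf_gt0// mulrC bnd.
have fe (b l : R) N : 0 <= b < 1 -> euler_psum b @ \oo --> l ->
    euler_psum (b * p ^+ N) @ \oo --> qpoch b p N * l.
  elim: N b l => [|N IH] b l b01 hl; first by rewrite expr0 mulr1 qpoch0 mul1r.
  have -> : qpoch b p N.+1 * l = qpoch (b * p) p N * ((1 - b) * l).
    by rewrite qpochSl; ring.
  rewrite exprS [b * (p * _)]mulrA.
  apply: IH (stab _ b01) _; rewrite -cvg_shiftS/=.
  under eq_fun => n.
    rewrite (_ : euler_psum _ _ = euler_psum b n.+1 - b * euler_psum b n).
      by over.
    by rewrite -euler_psumS; ring.
  have -> : (1 - b) * l = l - b * l by ring.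
  apply: cvgB; first by rewrite (cvg_shiftS (euler_psum b)).
  by apply: cvgM => //; exact: cvg_cst.
have [l hl] := cv a (introT andP (conj a0 a1)).
suff : qpoch_inf a p * l = 1.
  move=> h; suff <- : l = (qpoch_inf a p)^-1 by [].
  apply: (mulfI (x := qpoch_inf a p)); first by rewrite gt_eqF ?qpoch_inf_gt0.
  by rewrite h divff// gt_eqF ?qpoch_inf_gt0.
apply/eqP; rewrite eq_le; apply/andP; split.
  have h1 : (fun m => qpoch_inf a p * euler_psum a m.+1) @ \oo -->
      qpoch_inf a p * l.
    by apply: cvgM; [exact: cvg_cst|rewrite (cvg_shiftS (euler_psum a))].
  by apply: (@cvg_le_cst _ _ _ _ 0 h1) => m _; apply: bnd; rewrite a0 a1.
have h1 : (fun N => qpoch a p N * l) @ \oo --> qpoch_inf a p * l.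
  by apply: cvgM; [exact: cvg_qpoch|exact: cvg_cst].
apply: (@cvg_ge_cst _ _ _ _ 0 h1) => N _.
have h2 := fe a l N (introT andP (conj a0 a1)) hl.
apply: (@cvg_ge_cst _ _ _ _ 1 h2) => m m1; rewrite -(euler_psum1 (a * p ^+ N)).
by apply: euler_psum_nd => //; rewrite mulr_ge0 ?exprn_ge0 ?(ltW p0).
Unshelve. all: by end_near. Qed.

(** Euler's second identity, from F(x) = (1 + x) F(p x); for partial sums the
    two sides are ordered, in opposite ways after a shift of the length. *)
Lemma cvg_euler2_psum x : 0 <= x -> euler2_psum x @ \oo --> qpoch_inf (- x) p.
Proof.
move=> x0.
have up (b : R) m N : 0 <= b ->
    euler2_psum b m.+1 <= qpoch (- b) p N * euler2_psum (b * p ^+ N) m.+1.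
  elim: N b => [|N IH] b b0; first by rewrite qpoch0 mul1r expr0 mulr1.
  have bp : 0 <= b * p by rewrite mulr_ge0// ltW.
  apply: (@le_trans _ _ ((1 + b) * euler2_psum (b * p) m.+1)).
    rewrite mulrDl mul1r -lerBlDl euler2_psumS ler_wpM2l//.
    exact: (euler2_psum_nd bp (leqnSn m)).
  rewrite qpochSl opprK mulNr exprS [b * (p * _)]mulrA -[leRHS]mulrA.
  by rewrite ler_wpM2l ?addr_ge0// IH.
have lo (b : R) N : 0 <= b -> qpoch (- b) p N <= euler2_psum b N.+1.
  elim: N b => [|N IH] b b0; first by rewrite qpoch0 euler2_psum1.
  have bp : 0 <= b * p by rewrite mulr_ge0// ltW.
  apply: (@le_trans _ _ ((1 + b) * euler2_psum (b * p) N.+1)).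
    by rewrite qpochSl opprK mulNr ler_wpM2l ?addr_ge0// IH.
  have := euler2_psumS b N.+1.
  have := euler2_psum_nd bp (leqnSn N.+1).
  by rewrite mulrDl mul1r; lra.
have bnd m : euler2_psum x m.+1 <= qpoch_inf (- x) p.
  have h1 : (fun N => qpoch (- x) p N * euler2_psum (x * p ^+ N) m.+1) @ \oo -->
      qpoch_inf (- x) p.
    suff h : (fun N => qpoch (- x) p N * euler2_psum (x * p ^+ N) m.+1) @ \oo -->
      qpoch_inf (- x) p * 1 by rewrite mulr1 in h.
    apply: cvgM; first exact: cvg_qpoch.
    have := @cvg_psum0 (fun k => p ^+ 'C(k, 2) / qpoch p p k) _ m (cvg_expM x).
    by rewrite qpoch0 bin0n /= ?expr0 divr1.
  by apply: (@cvg_ge_cst _ _ _ _ 0 h1) => N _; exact: up.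
rewrite -cvg_shiftS/=.
apply: (squeeze_cvgr (f := qpoch (- x) p) (h := cst (qpoch_inf (- x) p))).
- by near=> N; rewrite lo ?bnd.
- exact: cvg_qpoch.
- exact: cvg_cst.
Unshelve. all: by end_near. Qed.

End EulerSeries.

(** * Integration over the half-line *)

Section HalfLine.
Variable R : realType.
Local Notation mu := (@lebesgue_measure R).
Implicit Types (f g G H : R -> R) (a b c x y t : R).

(** Behaviour at 0 and at +oo is left free, so that the class contains all the
    powers of t and is closed under products. *)
Definition nonneg_cont G : Prop :=
  forall t, 0 < t -> {for t, continuous G} /\ 0 <= G t.

Lemma nonneg_cont_measurable G : nonneg_cont G ->
  measurable_fun (`]0, +oo[ : set R) G.
Proof.
move=> cG; apply: open_continuous_measurable_fun; first exact: interval_open.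
by move=> t; rewrite inE/= in_itv/= andbT => /cG[].
Qed.

Lemma nonneg_cont_emeasurable G : nonneg_cont G ->
  measurable_fun (`]0, +oo[ : set R) (EFin \o G).
Proof. by move=> cG; apply/measurable_EFinP; exact: nonneg_cont_measurable. Qed.

Lemma nonneg_contM G H : nonneg_cont G -> nonneg_cont H ->
  nonneg_cont (fun t => G t * H t).
Proof.
move=> cG cH t t0; have [gc g0] := cG t t0; have [hc h0] := cH t t0.
by split; [exact: continuousM|rewrite mulr_ge0].
Qed.

Lemma nonneg_contD G H : nonneg_cont G -> nonneg_cont H ->
  nonneg_cont (fun t => G t + H t).
Proof.
move=> cG cH t t0; have [gc g0] := cG t t0; have [hc h0] := cH t t0.
by split; [exact: continuousD|rewrite addr_ge0].
Qed.

Lemma nonneg_cont_cst c : 0 <= c -> nonneg_cont (fun=> c).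
Proof. by move=> c0 t t0; split => //; exact: cst_continuous. Qed.

Lemma nonneg_cont_powR a : nonneg_cont (fun t => t `^ a).
Proof.
move=> t t0; split; last exact: powR_ge0.
apply: differentiable_continuous; apply/derivable1_diffP.
by apply: derivable_powR; rewrite in_itv/= t0.
Qed.

Lemma nonneg_cont_exp n : nonneg_cont (fun t => t ^+ n).
Proof.
by move=> t t0; split; [exact: exprn_continuous|rewrite exprn_ge0// ltW].
Qed.

Lemma continuous_monomial c n t : {for t, continuous (fun x : R => c * x ^+ n)}.
Proof.
by apply: continuousM; [exact: cst_continuous|exact: exprn_continuous].
Qed.

Lemma nonneg_cont_comp G c n : 0 < c -> nonneg_cont G ->
  nonneg_cont (fun t => G (c * t ^+ n)).
Proof.
move=> c0 cG t t0; have ct : 0 < c * t ^+ n by rewrite mulr_gt0// exprn_gt0.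
have [gc g0] := cG _ ct; split => //.
apply: (@continuous_comp _ _ _ (fun t => c * t ^+ n) G) => //.
exact: continuous_monomial.
Qed.

Lemma nonneg_contV G : nonneg_cont G -> (forall t, 0 < t -> 0 < G t) ->
  nonneg_cont (fun t => (G t)^-1).
Proof.
move=> cG G0 t t0; have [gc _] := cG t t0; have g0 := G0 t t0.
by split; [apply: continuousV => //; rewrite gt_eqF|rewrite invr_ge0 ltW].
Qed.

(** The half-line is exhausted by compact intervals, on which the integration
    theorems for continuous functions apply without any condition at the
    end points 0 and +oo. *)
Lemma cvg_integral_exhaust G (a b : nat -> R) (D : set R) : nonneg_cont G ->
  (forall n, 0 < a n) -> nonincreasing_seq a -> nondecreasing_seq b ->
  D = \bigcup_n `[a n, b n]%classic ->
  (\int[mu]_(x in `[a i, b i]) (G x)%:E)%E @[i --> \oo] -->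
  (\int[mu]_(x in D) (G x)%:E)%E.
Proof.
move=> cG a0 na nb ->; apply: ge0_nondecreasing_set_cvg_integral => //=.
- move=> m n mn; apply/subsetPset => t /=; rewrite !in_itv/= => /andP[h1 h2].
  by rewrite (le_trans _ h1) ?na//= (le_trans h2)// nb.
- move=> i; apply: measurable_funS (nonneg_cont_emeasurable cG) => //.
  by move=> t /=; rewrite !in_itv/= andbT => /andP[h _]; exact: lt_le_trans h.
- move=> i t; rewrite in_itv/= => /andP[h _]; rewrite lee_fin.
  by apply: (cG t _).2; exact: lt_le_trans h.
Qed.

Lemma halfline_bigcup (a b : nat -> R) : (forall n, 0 < a n) ->
  (forall t, 0 < t -> exists n, a n <= t <= b n) ->
  `]0, +oo[%classic = \bigcup_n `[a n, b n]%classic :> set R.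
Proof.
move=> a0 ab; apply/seteqP; split => [t /=|t [n _] /=]; rewrite !in_itv/= ?andbT.
  by move=> /ab[n tn]; exists n.
by move=> /andP[h _]; exact: lt_le_trans h.
Qed.

Lemma inv_le_halfline t : 0 < t -> exists n : nat, n.+1%:R^-1 <= t <= n.+1%:R.
Proof.
move=> t0; set z := Num.max t t^-1; exists (Num.truncn z).
have h : z < (Num.truncn z).+1%:R by exact: truncnS_gt.
apply/andP; split; last by rewrite (le_trans _ (ltW h))// le_max lexx.
rewrite -[leRHS]invrK lef_pV2 ?posrE ?invr_gt0 ?ltr0n//.
by rewrite (le_trans _ (ltW h))// le_max lexx orbT.
Qed.

(** The derivative of the substitution has no limit at +oo in general, which
    is why the identity is obtained on compact intervals first. *)
Lemma integral_power_subst G c n : 0 < c -> nonneg_cont G ->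
  (\int[mu]_(t in `]0%R, +oo[) (G t)%:E =
   \int[mu]_(x in `]0%R, +oo[)
      (G (c * x ^+ n.+1) * (c * (n.+1%:R * x ^+ n)))%:E)%E.
Proof.
move=> c0 cG; pose F x := c * x ^+ n.+1.
have dF x : is_derive x 1 F (c * (n.+1%:R * x ^+ n)).
  have h : is_derive x (1 : R) (fun y : R => y ^+ n.+1) (n.+1%:R * x ^+ n).
    by apply: DeriveDef; [exact: exprn_derivable|rewrite exp_derive /= /GRing.scale/= mulr1].
  rewrite (_ : c * _ = c *: (n.+1%:R * x ^+ n))//; exact: is_deriveZ.
have F'E : F^`()%classic = fun x => c * (n.+1%:R * x ^+ n).
  by apply/funext => x; rewrite derive1E (@derive_val _ _ _ _ _ _ _ (dF x)).
have cF' : continuous F^`()%classic.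
  rewrite F'E => x; have := @continuous_monomial (c * n.+1%:R) n x.
  by under [X in {for x, continuous X}]eq_fun do rewrite -mulrA.
have cF : continuous F by move=> x; exact: continuous_monomial.
have F0 x : 0 < x -> 0 < F x by move=> x0; rewrite mulr_gt0// exprn_gt0.
have Flt x y : 0 < x -> x < y -> F x < F y.
  by move=> x0 xy; rewrite ltr_pM2l// ltrXn2r// ltW.
have Fle x y : 0 < x -> x <= y -> F x <= F y.
  by move=> x0; rewrite le_eqVlt => /predU1P[->//|xy]; rewrite ltW// Flt.
pose a (i : nat) : R := i.+1%:R^-1; pose b (i : nat) : R := i.+1%:R.
have a0 i : 0 < a i by rewrite invr_gt0 ltr0n.
have b0 i : 0 < b i by rewrite ltr0n.
have ba i : a i <= b i.
  by rewrite (@le_trans _ _ 1)// ?ler1n// invf_le1 ?ltr0n// ler1n.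
have na : nonincreasing_seq a.
  by move=> i j ij; rewrite lef_pV2 ?posrE// ler_nat ltnS.
have nb : nondecreasing_seq b by move=> i j ij; rewrite ler_nat ltnS.
have h1 := @cvg_integral_exhaust _ (fun i => F (a i)) (fun i => F (b i)) `]0, +oo[%classic cG.
have cH : nonneg_cont (fun x => G (c * x ^+ n.+1) * (c * (n.+1%:R * x ^+ n))).
  apply: nonneg_contM; first exact: nonneg_cont_comp.
  apply: nonneg_contM; first exact/nonneg_cont_cst/ltW.
  by apply: nonneg_contM; [exact: nonneg_cont_cst|exact: nonneg_cont_exp].
have h2 := cvg_integral_exhaust cH a0 na nb (halfline_bigcup a0 inv_le_halfline).
apply: cvg_unique (h1 _ _ _ _) _ => //.
- by move=> i; exact: F0.
- by move=> i j ij; apply: Fle => //; exact: na.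
- by move=> i j ij; apply: Fle => //; exact: nb.
- apply: halfline_bigcup => [i|t t0]; first exact: F0.
  pose z := t / c.
  have z0 : 0 < z by rewrite divr_gt0.
  (* x ^ (n + 1) is at least x for x >= 1 and at most x for x <= 1 *)
  have [i /andP[h3 h4]] := inv_le_halfline z0; exists i.
  apply/andP; split; rewrite /F mulrC.
    rewrite -ler_pdivlMr// (le_trans _ h3)// exprS ler_piMr ?(ltW (a0 _))//.
    by rewrite exprn_ile1 ?(ltW (a0 _))// invf_le1 ?ltr0n// ler1n.
  rewrite -ler_pdivrMr// (le_trans h4)// exprS ler_peMr ?(ltW (b0 _))//.
  by rewrite exprn_ege1// ler1n.
suff -> : (fun i => \int[mu]_(x in `[F (a i), F (b i)]) (G x)%:E)%E =
  (fun i => \int[mu]_(x in `[a i, b i])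
      (G (c * x ^+ n.+1) * (c * (n.+1%:R * x ^+ n)))%:E)%E by exact: h2.
apply/funext => i; rewrite integration_by_substitution_increasing//.
- by apply: eq_integral => x _; rewrite F'E.
- by move=> x y; rewrite in_itv/= => /andP[x0 _] _; apply: Flt; exact: lt_le_trans x0.
- apply: (cvgP (F^`()%classic (a i))); apply: cvg_at_right_filter; exact: cF'.
- apply: (cvgP (F^`()%classic (b i))); apply: cvg_at_left_filter; exact: cF'.
- split.
  + by move=> x _; case: (dF x).
  + by apply: cvg_at_right_filter; exact: cF.
  + by apply: cvg_at_left_filter; exact: cF.
- apply: continuous_in_subspaceT => x; rewrite inE/= in_itv/= => /andP[h _].
  by apply: (cG x _).1; exact: lt_le_trans (F0 _ (a0 i)) h.
Qed.

End HalfLine.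

(** * Mellin transforms *)

Section Mellin.
Variable R : realType.
Local Notation mu := (@lebesgue_measure R).
Implicit Types (f g G H : R -> R) (a b c x y t : R).

Definition mellin G y : \bar R :=
  (\int[mu]_(t in `]0%R, +oo[) (t `^ (y - 1) * G t)%:E)%E.

Lemma nonneg_cont_mellin G y : nonneg_cont G ->
  nonneg_cont (fun t => t `^ (y - 1) * G t).
Proof. by move=> cG; apply: nonneg_contM => //; exact: nonneg_cont_powR. Qed.

Lemma eq_mellin G H y : (forall t, 0 < t -> G t = H t) -> mellin G y = mellin H y.
Proof.
move=> GH; apply: eq_integral => t; rewrite inE/= in_itv/= andbT => t0.
by rewrite GH.
Qed.

Lemma mellin_ge0 G y : nonneg_cont G -> (0 <= mellin G y)%E.
Proof.
move=> cG; apply: integral_ge0 => t /=; rewrite in_itv/= andbT => t0.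
by rewrite lee_fin; exact: (nonneg_cont_mellin y cG t0).2.
Qed.

Lemma mellinD G H y : nonneg_cont G -> nonneg_cont H ->
  mellin (fun t => G t + H t) y = (mellin G y + mellin H y)%E.
Proof.
move=> cG cH; rewrite /mellin -ge0_integralD//.
- by apply: eq_integral => t _; rewrite mulrDr.
- move=> t /=; rewrite in_itv/= andbT => t0.
  by rewrite lee_fin; exact: (nonneg_cont_mellin y cG t0).2.
- exact: nonneg_cont_emeasurable (nonneg_cont_mellin y cG).
- move=> t /=; rewrite in_itv/= andbT => t0.
  by rewrite lee_fin; exact: (nonneg_cont_mellin y cH t0).2.
- exact: nonneg_cont_emeasurable (nonneg_cont_mellin y cH).
Qed.

Lemma mellinZ G k y : nonneg_cont G -> 0 <= k ->
  mellin (fun t => k * G t) y = (k%:E * mellin G y)%E.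
Proof.
move=> cG k0; rewrite /mellin -ge0_integralZl_EFin//.
- by apply: eq_integral => t _; rewrite mulrCA.
- move=> t /=; rewrite in_itv/= andbT => t0.
  by rewrite lee_fin; exact: (nonneg_cont_mellin y cG t0).2.
- exact: nonneg_cont_emeasurable (nonneg_cont_mellin y cG).
Qed.

Lemma mellinXM G k y : mellin (fun t => t ^+ k * G t) y = mellin G (y + k%:R).
Proof.
apply: eq_integral => t; rewrite inE/= in_itv/= andbT => t0; congr EFin.
rewrite mulrA; congr (_ * _).
rewrite -powR_mulrn ?(ltW t0)// -powRD; last by rewrite (gt_eqF t0) implybT.
by congr (_ `^ _); ring.
Qed.

(** Scalings (n = 0) and the substitutions t := t ^ 2 and t := t ^ 3 are the
    only changes of variables needed below. *)
Lemma mellin_subst G c n y : 0 < c -> nonneg_cont G ->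
  mellin G y = ((n.+1%:R * c `^ y)%:E
                 * mellin (fun t => G (c * t ^+ n.+1)%R) (n.+1%:R * y)%R)%E.
Proof.
move=> c0 cG; rewrite -mellinZ//; last 2 first.
- exact: nonneg_cont_comp.
- by rewrite mulr_ge0// powR_ge0.
rewrite /mellin (@integral_power_subst _ _ c n c0 (nonneg_cont_mellin y cG)).
apply: eq_integral => t; rewrite inE/= in_itv/= andbT => t0; congr EFin.
have tn0 : 0 <= t ^+ n.+1 by rewrite exprn_ge0// ltW.
rewrite powRM ?(ltW c0)// -powR_mulrn ?(ltW t0)// -powRrM.
rewrite -powR_mulrn ?(ltW t0)//.
have cE : c `^ y = c `^ (y - 1) * c.
  rewrite -[X in _ * X]powRr1 ?(ltW c0)// -powRD; last by rewrite (gt_eqF c0) implybT.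
  by congr (_ `^ _); ring.
have tE : t `^ (n.+1%:R * y - 1) = t `^ (n.+1%:R * (y - 1)) * t `^ n%:R.
  rewrite -powRD; last by rewrite (gt_eqF t0) implybT.
  by congr (_ `^ _); rewrite -natr1; ring.
by rewrite cE tE; ring.
Qed.

Lemma mellin_scale G c y : 0 < c -> nonneg_cont G ->
  mellin (fun t => G (c * t)) y = ((c `^ (- y))%:E * mellin G y)%E.
Proof.
move=> c0 cG; have cy : c `^ y != 0 by rewrite gt_eqF// powR_gt0.
rewrite (@mellin_subst G c 0 y c0 cG) muleA -EFinM !mul1r powRN mulVf// mul1e.
by apply: eq_mellin => t t0; rewrite expr1.
Qed.

(** Convergence of the primitive along the two sequences of end points replaces
    its continuity at the possibly singular end points. *)
Lemma integral_exhaust_FTC G F (a b : nat -> R) (D : set R) lA lB :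
  nonneg_cont G -> (forall t, 0 < t -> is_derive t (1 : R) F (G t)) ->
  (forall n, 0 < a n) -> (forall n, a n <= b n) ->
  nonincreasing_seq a -> nondecreasing_seq b ->
  D = \bigcup_n `[a n, b n]%classic ->
  F \o a @ \oo --> lA -> F \o b @ \oo --> lB ->
  (\int[mu]_(t in D) (G t)%:E = (lB - lA)%:E)%E.
Proof.
move=> cG dF a0 ab na nb DE FA FB.
have h1 := cvg_integral_exhaust cG a0 na nb DE.
have cF t : 0 < t -> {for t, continuous F}.
  move=> t0; apply: differentiable_continuous; apply/derivable1_diffP.
  by case: (dF t t0).
suff h2 : (fun i => (\int[mu]_(t in `[a i, b i]) (G t)%:E)%E) =
    (fun i => (F (b i) - F (a i))%:E).
  rewrite h2 in h1.
  have h3 : (fun i => (F (b i) - F (a i))%:E) @ \oo --> (lB - lA)%:E.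
    by apply: cvg_EFin; [exact: nearW|exact: cvgB].
  exact: (cvg_unique _ h1 h3).
apply/funext => i; have := ab i; rewrite le_eqVlt => /predU1P[->|abi].
  by rewrite set_itv1 integral_set1 subrr.
rewrite (@continuous_FTC2 _ G F)//.
- apply: continuous_in_subspaceT => t; rewrite inE/= in_itv/= => /andP[h _].
  by apply: (cG t _).1; exact: lt_le_trans h.
- split.
  + move=> t; rewrite in_itv/= => /andP[h _].
    by case: (dF t (lt_trans (a0 i) h)).
  + by apply: cvg_at_right_filter; apply: cF.
  + by apply: cvg_at_left_filter; apply: cF; exact: lt_trans abi.
- move=> t; rewrite in_itv/= => /andP[h _]; rewrite derive1E.
  by apply: (@derive_val _ _ _ _ _ _ _ (dF t (lt_trans (a0 i) h))).
Qed.

Definition itv_lo n : R := n.+1%:R^-1.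
Definition itv_hi n : R := n.+1%:R.

Lemma itv_lo_gt0 n : 0 < itv_lo n. Proof. by rewrite invr_gt0 ltr0n. Qed.

Lemma itv_lo_le1 n : itv_lo n <= 1.
Proof. by rewrite invf_le1 ?ltr0n// ler1n. Qed.

Lemma itv_hi_ge1 n : 1 <= itv_hi n. Proof. by rewrite ler1n. Qed.

Lemma itv_lo_nincr : nonincreasing_seq itv_lo.
Proof. by move=> i j ij; rewrite lef_pV2 ?posrE ?ltr0n// ler_nat ltnS. Qed.

Lemma itv_hi_ndecr : nondecreasing_seq itv_hi.
Proof. by move=> i j ij; rewrite ler_nat ltnS. Qed.

Lemma cvg_itv_lo : itv_lo @ \oo --> (0 : R).
Proof. exact: cvg_harmonic. Qed.

Lemma cvg_itv_lo_powR s : 0 < s -> (fun n => itv_lo n `^ s) @ \oo --> (0 : R).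
Proof.
move=> s0; have /cvg_at_rightP := @powR_cvg0 R s s0; apply.
by split; [exact: itv_lo_gt0|exact: cvg_itv_lo].
Qed.

Lemma unit_itv_bigcup :
  `]0, 1]%classic = \bigcup_n `[itv_lo n, 1]%classic :> set R.
Proof.
apply/seteqP; split => [t /=|t [n _] /=]; rewrite !in_itv/=.
  move=> /andP[t0 t1]; have [n /andP[h _]] := inv_le_halfline t0.
  by exists n => //=; rewrite in_itv/= h.
by move=> /andP[h ->]; rewrite (lt_le_trans (itv_lo_gt0 n)).
Qed.

Lemma ge1_itv_bigcup :
  `[1, +oo[%classic = \bigcup_n `[1, itv_hi n]%classic :> set R.
Proof.
apply/seteqP; split => [t /=|t [n _] /=]; rewrite !in_itv/= andbT; last by case/andP.
move=> t1; have [n /andP[_ h]] := inv_le_halfline (lt_le_trans ltr01 t1).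
by exists n => //=; rewrite in_itv/= t1.
Qed.

Lemma is_derive_powR s t : s != 0 -> 0 < t ->
  is_derive t (1 : R) (fun x => x `^ s / s) (t `^ (s - 1)).
Proof.
move=> s0 t0; have t1 : t \in `]0, +oo[ by rewrite in_itv/= t0.
have h : is_derive t (1 : R) (fun x => x `^ s) (s * t `^ (s - 1)).
  apply: DeriveDef; first exact: derivable_powR.
  by rewrite -derive1E powR_derive1.
rewrite (_ : (fun x => x `^ s / s) = s^-1 \*: (fun x => x `^ s)); last first.
  by apply/funext => x; rewrite mulrC.
by apply: (is_derive_eq (is_deriveZ s^-1 h)); rewrite /GRing.scale/= mulKf.
Qed.

Lemma integral_powR_unit s : 0 < s ->
  (\int[mu]_(t in `]0%R, 1%R]) (t `^ (s - 1))%:E = (s^-1)%:E)%E.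
Proof.
move=> s0; have sn0 : s != 0 by rewrite gt_eqF.
have dF t (t0 : 0 < t) := is_derive_powR sn0 t0.
rewrite (@integral_exhaust_FTC _ (fun x => x `^ s / s) itv_lo (fun=> 1)
    _ (0 / s) (1 `^ s / s) (@nonneg_cont_powR _ _) dF)//.
- by rewrite powR1 mul0r subr0 mul1r.
- exact: itv_lo_gt0.
- exact: itv_lo_le1.
- exact: itv_lo_nincr.
- exact: unit_itv_bigcup.
- by apply: cvgM; [exact: cvg_itv_lo_powR|exact: cvg_cst].
- exact: cvg_cst.
Qed.

Lemma integral_powR_ge1 s : s < 0 ->
  (\int[mu]_(t in `[1%R, +oo[) (t `^ (s - 1))%:E = ((- s)^-1)%:E)%E.
Proof.
move=> s0; have sn0 : s != 0 by rewrite lt_eqF.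
have dF t (t0 : 0 < t) := is_derive_powR sn0 t0.
rewrite (@integral_exhaust_FTC _ (fun x => x `^ s / s) (fun=> 1) itv_hi
    _ (1 `^ s / s) (0 / s) (@nonneg_cont_powR _ _) dF)//.
- by rewrite powR1 mul0r sub0r mul1r invrN.
- exact: itv_hi_ge1.
- exact: itv_hi_ndecr.
- exact: ge1_itv_bigcup.
- exact: cvg_cst.
- apply: cvgM; last exact: cvg_cst.
  have E : (fun n => itv_hi n `^ s) = (fun n => itv_lo n `^ (- s)).
    apply/funext => n; rewrite /= /itv_lo -powR_inv1 ?ler0n// -powRrM.
    by rewrite mulN1r opprK.
  suff : (fun n => itv_hi n `^ s) @ \oo --> (0 : R) by [].
  by rewrite E; apply: cvg_itv_lo_powR; rewrite oppr_gt0.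
Qed.

Lemma halfline_split G : nonneg_cont G ->
  (\int[mu]_(t in `]0%R, +oo[) (G t)%:E =
   \int[mu]_(t in `]0%R, 1%R]) (G t)%:E + \int[mu]_(t in `[1%R, +oo[) (G t)%:E)%E.
Proof.
move=> cG.
have mG := nonneg_cont_emeasurable cG.
rewrite -[in X in (_ + X)%E]integral_itv_obnd_cbnd; last first.
  apply: measurable_funS mG => // t /=; rewrite !in_itv/= !andbT.
  exact: lt_trans.
have -> : `]0, +oo[%classic = `]0, 1]%classic `|` `]1, +oo[%classic :> set R.
  apply/seteqP; split => [t /=|t [|] /=]; rewrite !in_itv/= ?andbT.
  - by move=> t0; have [t1|t1] := leP t 1; [left|right]; rewrite ?t0.
  - by case/andP.
  - exact: lt_trans.
have E : (`]0, 1] : set R) `|` `]1, +oo[ `<=` `]0, +oo[.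
  by move=> t [|] /=; rewrite !in_itv/= ?andbT; [case/andP|exact: lt_trans].
rewrite ge0_integral_setU//.
- by apply: measurable_funS mG.
- move=> t /E /=; rewrite in_itv/= andbT lee_fin => t0; exact: (cG t t0).2.
- rewrite disj_set2E; apply/eqP/seteqP; split => // t [] /=; rewrite !in_itv/=.
  by move=> /andP[_ h]; rewrite andbT ltNge h.
Qed.

End Mellin.

(** * Herglotz's argument *)

Section Herglotz.
Variable R : realType.
Implicit Types (f g : R -> R) (M x y : R).

(** Sums, opposites and bounded monotone functions have this property, which
    is all that the argument of Herglotz requires of a function. *)
Definition alt_bounded f M : Prop := forall N (x : nat -> R),
  (forall k, (k < N)%N -> 0 < x k < 1) -> (forall k, x k <= x k.+1) ->
  `|\sum_(0 <= k < N) (-1) ^+ k * f (x k)| <= M.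

Lemma alt_boundedD f g M M' : alt_bounded f M -> alt_bounded g M' ->
  alt_bounded (fun x => f x + g x) (M + M').
Proof.
move=> hf hg N x x01 xS; under eq_bigr do rewrite mulrDr.
by rewrite big_split/= (le_trans (ler_normD _ _))// lerD ?hf ?hg.
Qed.

Lemma alt_boundedN f M : alt_bounded f M -> alt_bounded (fun x => - f x) M.
Proof.
move=> hf N x x01 xS; under eq_bigr do rewrite mulrN.
by rewrite sumrN normrN hf.
Qed.

(** The centred partial sums S_n + (-1) ^ n c_n / 2 move by half the
    decrements of c, so that their displacements telescope. *)
Lemma alt_bounded_nincr f M :
  (forall x, 0 < x < 1 -> `|f x| <= M) ->
  (forall x y, 0 < x -> x <= y -> y < 1 -> f y <= f x) ->
  alt_bounded f (M *+ 2).
Proof.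
move=> fM fn [|N] x x01 xS.
  rewrite big_nil normr0 mulrn_wge0// (le_trans _ (fM (2^-1) _))//.
  by rewrite invr_gt0 ltr0n invf_lt1 ?ltr1n ?ltr0n.
pose T n := \sum_(0 <= k < n) (-1) ^+ k * f (x k) + (-1) ^+ n * f (x n) / 2.
have TS n : (n <= N)%N -> `|T n - T 0| <= (f (x 0) - f (x n)) / 2.
  elim: n => [|n IH] nN; first by rewrite !subrr normr0 mul0r.
  have -> : T n.+1 - T 0 =
      (T n - T 0) + (-1) ^+ n * ((f (x n) - f (x n.+1)) / 2).
    by rewrite /T [in LHS]big_nat_recr//= exprS; field.
  rewrite (le_trans (ler_normD _ _))// normrM normrX normrN1 expr1n mul1r.
  have fle : f (x n.+1) <= f (x n).
    have /andP[h1 _] := x01 n (leqW nN).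
    by have /andP[_ h2] := x01 n.+1 nN; apply: fn.
  rewrite [X in _ + X <= _]ger0_norm ?divr_ge0 ?subr_ge0//.
  by have := IH (ltnW nN); lra.
have -> : \sum_(0 <= k < N.+1) (-1) ^+ k * f (x k) =
    (T N - T 0) + (f (x 0) / 2 + (-1) ^+ N * f (x N) / 2).
  by rewrite /T big_nat_recr//= big_nil expr0; field.
rewrite (le_trans (ler_normD _ _))//.
have h0 := fM _ (x01 0 isT); have hN := fM _ (x01 N (leqnn _)).
have h1 := TS N (leqnn _).
have h2 : `|f (x 0) / 2 + (-1) ^+ N * f (x N) / 2| <= M.
  rewrite (le_trans (ler_normD _ _))// !normrM normrX normrN1 expr1n mul1r.
  by rewrite [`|2^-1|]gtr0_norm//; lra.
by move: h0 hN; rewrite !ler_norml => /andP[? ?] /andP[? ?]; lra.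
Qed.

Lemma sum_by_three (V : zmodType) (F : nat -> V) n :
  \sum_(0 <= k < 3 * n) F k =
  \sum_(0 <= k < n) (F (3 * k)%N + F (3 * k).+1 + F (3 * k).+2).
Proof.
elim: n => [|n IH]; first by rewrite muln0 !big_nil.
by rewrite mulnS !addSn add0n !big_nat_recr//= IH !addrA.
Qed.

(** Herglotz's argument: iterating the trisection relation expresses 3 ^ m D(y)
    as an alternating sum of 3 ^ m values of D, which remains bounded. *)
Lemma trisection_eq0 f M : alt_bounded f M ->
  (forall y, 0 < y < 1 ->
     3 * f y = f (y / 3) - f ((y + 1) / 3) + f ((y + 2) / 3)) ->
  forall y, 0 < y < 1 -> f y = 0.
Proof.
move=> fM f3.
have it m y : 0 < y < 1 -> 3 ^+ m * f y =
    \sum_(0 <= k < 3 ^ m) (-1) ^+ k * f ((y + k%:R) / 3 ^+ m).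
  elim: m y => [|m IH] y y01.
    by rewrite expn0 big_nat1 !expr0 addr0 divr1.
  rewrite expnS sum_by_three [in LHS]exprSr -mulrA f3// mulrDr mulrBr.
  rewrite !IH; [|lra..].
  rewrite -sumrB -big_split/=; apply: eq_bigr => k _.
  have E (j : nat) :
      (y + (3 * k + j)%:R) / 3 ^+ m.+1 = ((y + j%:R) / 3 + k%:R) / 3 ^+ m.
    by rewrite natrD natrM exprS; field; rewrite expf_neq0// pnatr_eq0.
  have := E 0%N; have := E 1%N; have := E 2%N.
  rewrite addn0 addn1 addn2 addr0 => -> -> ->.
  have S : (-1) ^+ (3 * k) = (-1) ^+ k :> R by rewrite -signr_odd oddM signr_odd.
  by rewrite !exprS S; ring.
move=> y y01; apply/eqP; apply: contraT => fy0.
have hM m : 3 ^+ m * `|f y| <= M.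
  rewrite -[X in X * _]ger0_norm ?exprn_ge0// -normrM it//.
  have p3 : (0 : R) < 3 ^+ m by rewrite exprn_gt0.
  apply: fM => [k km|k].
    have k1 : (k%:R : R) + 1 <= 3 ^+ m by rewrite -natrX natr1 ler_nat.
    have k0 : (0 : R) <= k%:R by rewrite ler0n.
    move/andP: y01 => [y0 y1].
    by rewrite divr_gt0 ?ltr_pdivrMr//=; lra.
  by rewrite ler_pM2r ?invr_gt0// lerD2l ler_nat.
have fp : 0 < `|f y| by rewrite normr_gt0.
pose m := Num.truncn (M / `|f y|).
have : M < 3 ^+ m * `|f y|.
  rewrite -ltr_pdivrMr// (lt_le_trans (truncnS_gt _))// -/m.
  by rewrite -natrX ler_nat ltn_expl.
by rewrite ltNge hM.
Qed.

End Herglotz.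

(** * The cosecant *)

Section Cosecant.
Variable R : realType.
Implicit Types (f : R -> R) (x y : R).

Lemma is_derive_le (f f' : R -> R) a b : a <= b ->
  (forall x, a <= x <= b -> is_derive x (1 : R) f (f' x)) ->
  (forall x, a < x < b -> 0 <= f' x) -> f a <= f b.
Proof.
rewrite le_eqVlt => /predU1P[->//|ab] df f0.
have [||c] := @MVT _ f f' a b ab.
- by move=> x /[!in_itv]/= /andP[xa xb]; apply: df; rewrite !ltW.
- apply: derivable_within_continuous => x /[!in_itv]/= xab.
  by case: (df x xab).
by rewrite in_itv/= => cab h; rewrite -subr_ge0 h mulr_ge0 ?f0// subr_ge0 ltW.
Qed.

Lemma sin_le_id x : 0 <= x -> sin x <= x.
Proof.
move=> x0; have := @is_derive_le (fun x => x - sin x) (fun x => 1 - cos x) 0 x x0.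
rewrite sin0 subrr subr_ge0; apply.
by move=> y _; rewrite subr_ge0 cos_le1.
Qed.

Lemma mul_cos_le_sin x : 0 <= x <= pi -> x * cos x <= sin x.
Proof.
move=> /andP[x0 xpi].
have := @is_derive_le (fun x => sin x - x * cos x) (fun x => x * sin x) 0 x x0.
rewrite sin0 mul0r subrr subr_ge0; apply.
  move=> y _; have h : is_derive y (1 : R) (@sin R - (@id R : R -> R) * @cos R)
      (cos y - (y *: (- sin y) + cos y *: 1)) by exact: is_deriveB.
  apply: (is_derive_eq h).
  by rewrite /GRing.scale/= mulr1; ring.
move=> y /andP[y0 yx]; rewrite mulr_ge0 ?(ltW y0)// sin_ge0_pi//.
by rewrite (ltW y0)/= (le_trans (ltW yx)).
Qed.

(** The regular part of the cotangent at 0. *)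
Definition cot_reg x : R := cos x / sin x - x^-1.

Lemma cot_reg_nincr x y : 0 < x -> x <= y -> y <= pi / 2 ->
  cot_reg y <= cot_reg x.
Proof.
move=> x0 xy ypi.
pose f' z := (sin z)^-2 - z^-2 : R.
have pos z : x <= z <= y -> 0 < z /\ 0 < sin z.
  move=> /andP[xz zy]; have z0 : 0 < z by exact: lt_le_trans xz.
  split => //; apply: sin_gt0_pi; rewrite z0/=.
  by have := @pi_gt0 R; lra.
have := @is_derive_le (fun z => - cot_reg z) f' x y xy.
rewrite lerN2; apply.
  move=> z /pos[z0 sz0]; rewrite /cot_reg /f'.
  have s0 : sin z != 0 by rewrite gt_eqF.
  have zn0 : z != 0 by rewrite gt_eqF.
  have d1 : is_derive z (1 : R) (fun z => (sin z)^-1) (- (sin z)^-2 *: cos z).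
    exact: is_deriveV.
  have d2 : is_derive z (1 : R) (fun z : R => z^-1) (- z ^-2 *: 1).
    exact: is_deriveV.
  have d3 := is_deriveB (is_deriveM (is_derive_cos z) d1) d2.
  have d4 := is_deriveN d3; apply: (is_derive_eq d4).
  have := cos2Dsin2 z; rewrite /GRing.scale/= mulr1 => h.
  have -> : cos z * (- (sin z)^-2 * cos z) + (sin z)^-1 * (- sin z) =
      - (cos z ^+ 2 + sin z ^+ 2) / sin z ^+ 2.
    by field; rewrite s0.
  by rewrite h; field; rewrite s0 zn0.
move=> z /andP[xz zy]; have [z0 sz0] := pos z (introT andP (conj (ltW xz) (ltW zy))).
rewrite subr_ge0 lef_pV2 ?posrE ?exprn_gt0// lerXn2r ?nnegrE ?(ltW z0) ?(ltW sz0)//.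
exact/sin_le_id/ltW.
Qed.

Lemma cot_reg_bounded x : 0 < x <= pi / 2 -> `|cot_reg x| <= 1.
Proof.
move=> /andP[x0 xpi]; have pi0 := @pi_gt0 R.
have sx : 0 < sin x by apply: sin_gt0_pi; rewrite x0/=; lra.
rewrite ler_norml; apply/andP; split.
  apply: le_trans (cot_reg_nincr x0 xpi (lexx _)).
  rewrite /cot_reg cos_pihalf mul0r add0r lerN2 invf_le1 ?divr_gt0//.
  exact: pihalf_ge1.
rewrite (@le_trans _ _ 0)// /cot_reg subr_le0 ler_pdivrMr// mulrC.
rewrite ler_pdivlMr// mulrC; apply: mul_cos_le_sin; lra.
Qed.

(** Since 2 / sin 2z = cot z + tan z, the cosecant is its two polar parts plus
    two bounded monotone functions. *)
Lemma csc_cot x : 0 < x < 1 ->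
  pi / sin (pi * x) = x^-1 + (1 - x)^-1
     + (pi / 2 * cot_reg (pi / 2 * x) + pi / 2 * cot_reg (pi / 2 * (1 - x))).
Proof.
move=> /andP[x0 x1]; have pi0 := @pi_gt0 R.
set z := pi / 2 * x.
have -> : pi / 2 * (1 - x) = pi / 2 - z by rewrite /z mulrBr mulr1.
rewrite /cot_reg cosB sinB cos_pihalf sin_pihalf !mul0r !mul1r add0r subr0.
have -> : pi * x = z *+ 2 by rewrite /z mulr2n; field.
have hz : 0 < z < pi / 2.
  by rewrite mulr_gt0 ?divr_gt0//= gtr_pMr ?divr_gt0.
have s0 : sin z != 0 by rewrite gt_eqF// sin_gt0_pihalf.
have c0 : cos z != 0 by rewrite gt_eqF// cos_gt0_pihalf//; lra.
have -> : z^-1 = (pi / 2)^-1 * x^-1 by rewrite invfM.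
have -> : (pi / 2 - z)^-1 = (pi / 2)^-1 * (1 - x)^-1.
  by rewrite -invfM /z mulrBr mulr1.
rewrite sin_mulr2n -mulr_natl.
have hpi : pi = pi * (cos z ^+ 2 + sin z ^+ 2) by rewrite cos2Dsin2 mulr1.
rewrite [in LHS]hpi.
have pn0 : (pi : R) != 0 by rewrite gt_eqF.
have x10 : 1 - x != 0 by rewrite subr_eq0 gt_eqF.
have xn0 : x != 0 by rewrite gt_eqF.
move: pn0; clearbody z; move: (pi : R) => P pn0.
by field; rewrite s0 c0 pn0 x10 xn0.
Qed.

Lemma triple_angle_root (c s : R) : 0 < s -> 0 < c ->
  (c * s) *+ 2 * c + (c ^+ 2 *+ 2 - 1) * s = 0 -> c = 2^-1.
Proof.
move=> s0 c0.
have -> : (c * s) *+ 2 * c + (c ^+ 2 *+ 2 - 1) * s =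
    s * ((2 * c + 1) * (2 * c - 1)) by rewrite !mulr2n; ring.
move=> /eqP; rewrite !mulf_eq0 (gt_eqF s0) orFb => /orP[|] /eqP; lra.
Qed.

(** From the triple-angle formula for the sine at pi / 3. *)
Lemma cos_pi3 : cos (pi / 3) = 2^-1 :> R.
Proof.
have pi0 := @pi_gt0 R.
apply: (@triple_angle_root _ (sin (pi / 3))).
- by apply: sin_gt0_pi; apply/andP; split; lra.
- by apply: cos_gt0_pihalf; apply/andP; split; lra.
rewrite -sin_mulr2n -cos_mulr2n -sinD -[RHS]sinpi; congr sin.
by rewrite mulr2n; field.
Qed.

(** With u = sin t, sin 3t = 4 u (3 / 4 - u ^ 2), where the second factor is up to
    sign the product of the sines of t + pi / 3 and t - pi / 3: the relation is the
    decomposition of 1 / sin 3t into partial fractions. *)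
Lemma csc_trisection x : 0 < x < 1 ->
  3 * (pi / sin (pi * x)) = pi / sin (pi * (x / 3))
    - pi / sin (pi * ((x + 1) / 3)) + pi / sin (pi * ((x + 2) / 3)) :> R.
Proof.
move=> /andP[x0 x1]; have pi0 := @pi_gt0 R.
have spos y : 0 < y < 1 -> sin (pi * y) != 0 :> R.
  move=> /andP[y0 y1]; rewrite gt_eqF// sin_gt0_pi// mulr_gt0//=.
  by rewrite gtr_pMr.
set t := pi * (x / 3); pose c := cos (pi / 3) : R; pose s := sin (pi / 3) : R.
have e1 : pi * ((x + 1) / 3) = t + pi / 3 by rewrite /t; field.
have e2 : pi * ((x + 2) / 3) = (t - pi / 3) + pi by rewrite /t; field.
have e0 : pi * x = t *+ 2 + t by rewrite /t mulr2n; field.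
have h0 : sin t != 0 by apply: spos; lra.
have h1 : sin (t + pi / 3) != 0 by rewrite -e1; apply: spos; lra.
have h2 : sin (t - pi / 3) != 0.
  by rewrite -oppr_eq0 -sinDpi -e2; apply: spos; lra.
have h3 : sin (t *+ 2 + t) != 0 by rewrite -e0; apply: spos; lra.
rewrite e0 e1 e2 sinDpi.
have cs : c ^+ 2 + s ^+ 2 = 1 by exact: cos2Dsin2.
have cE : c = 2^-1 by exact: cos_pi3.
move: h1 h2 h3; rewrite sinD sinB -/c -/s sinD sin_mulr2n cos_mulr2n cE.
have sE : s ^+ 2 = 3 / 4 by have := cs; rewrite cE; lra.
have ct : cos t ^+ 2 = 1 - sin t ^+ 2 by exact: cos2sin2.
move: h0 ct; set u := sin t; set w := cos t => h0 ct h1 h2.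
have -> : (w * u) *+ 2 * w + (w ^+ 2 *+ 2 - 1) * u = u * (3 - 4 * u ^+ 2).
  have -> : (w * u) *+ 2 * w + (w ^+ 2 *+ 2 - 1) * u = u * (4 * w ^+ 2 - 1).
    by rewrite !mulr2n; ring.
  by rewrite ct; ring.
move=> h3.
have h12 : (u / 2 + w * s) * (u / 2 - w * s) = u ^+ 2 - 3 / 4.
  have -> : (u / 2 + w * s) * (u / 2 - w * s) = u ^+ 2 / 4 - w ^+ 2 * s ^+ 2.
    by field.
  by rewrite ct sE; field.
rewrite -[in RHS]addrA.
have addf (P A B : R) : A != 0 -> B != 0 ->
    - (P / A) + P / - B = - P * (A + B) / (A * B).
  by move=> A0 B0; field; rewrite A0 B0.
rewrite addf// h12; have -> : u / 2 + w * s + (u / 2 - w * s) = u by field.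
have {}h3 : 3 - 4 * u ^+ 2 != 0 by apply: contraNneq h3 => ->; rewrite mulr0.
have -> : u ^+ 2 - 3 / 4 = - (3 - 4 * u ^+ 2) / 4 by field.
by move: (pi : R) => P; field; rewrite h3 h0.
Qed.

End Cosecant.

(** * Euler's reflection integral *)

Section Reflection.
Variable R : realType.
Local Notation mu := (@lebesgue_measure R).
Implicit Types (f g G H : R -> R) (a b c x y t : R) (D : set R).

Lemma nonneg_cont_affine a b : 0 <= a -> 0 <= b -> nonneg_cont (fun t => a + b * t).
Proof.
move=> a0 b0; apply: nonneg_contD; first exact: nonneg_cont_cst.
apply: nonneg_contM; first exact: nonneg_cont_cst.
by move=> t t0; split; [exact: cvg_id|exact: ltW].
Qed.

Definition cauchy_ker t : R := (1 + t)^-1.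

Lemma nonneg_cont_cauchy : nonneg_cont cauchy_ker.
Proof.
apply: nonneg_contV; last by move=> t t0; rewrite addr_gt0.
have := @nonneg_cont_affine 1 1 ler01 ler01.
by under eq_fun do rewrite mul1r.
Qed.

Definition part_mellin D s : \bar R :=
  (\int[mu]_(t in D) (t `^ (s - 1) * cauchy_ker t)%:E)%E.

Section Part.
Variable D : set R.
Hypotheses (mD : measurable D) (D0 : D `<=` `]0, +oo[).

Let pos t : D t -> 0 < t. Proof. by move/D0; rewrite /= in_itv/= andbT. Qed.

Lemma le_part_integral G H : nonneg_cont G -> nonneg_cont H ->
  (forall t, D t -> G t <= H t) ->
  (\int[mu]_(t in D) (G t)%:E <= \int[mu]_(t in D) (H t)%:E)%E.
Proof.
move=> cG cH GH; apply: ge0_le_integral => //.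
- by move=> t /pos t0; rewrite lee_fin; exact: (cG t t0).2.
- by apply: measurable_funS D0 (nonneg_cont_emeasurable cG).
- by apply: measurable_funS D0 (nonneg_cont_emeasurable cH).
Qed.

(** Because t ^ (s - 1) + t ^ s = t ^ (s - 1) (1 + t). *)
Lemma part_mellinS s : (part_mellin D s + part_mellin D (s + 1) =
  \int[mu]_(t in D) (t `^ (s - 1))%:E)%E.
Proof.
have c1 s' := nonneg_contM (@nonneg_cont_powR R (s' - 1)) nonneg_cont_cauchy.
rewrite /part_mellin -ge0_integralD//.
- apply: eq_integral => t; rewrite inE => /pos t0; rewrite -EFinD; congr EFin.
  have -> : t `^ (s + 1 - 1) = t * t `^ (s - 1).
    rewrite -[X in X * _]powRr1 ?(ltW t0)// -powRD; last by rewrite (gt_eqF t0) implybT.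
    by congr (_ `^ _); ring.
  rewrite /cauchy_ker; field.
  by rewrite gt_eqF// addr_gt0.
- by move=> t /pos t0; rewrite lee_fin; exact: (c1 s t t0).2.
- by apply: measurable_funS D0 (nonneg_cont_emeasurable (c1 s)).
- by move=> t /pos t0; rewrite lee_fin; exact: (c1 (s + 1) t t0).2.
- by apply: measurable_funS D0 (nonneg_cont_emeasurable (c1 (s + 1))).
Qed.

Lemma part_mellin_ge0 s : (0 <= part_mellin D s)%E.
Proof.
apply: integral_ge0 => t /pos t0; rewrite lee_fin.
by rewrite mulr_ge0 ?powR_ge0// invr_ge0 addr_ge0// ltW.
Qed.

End Part.

Let D0 : set R := `]0, 1].
Let D1 : set R := `[1, +oo[.

Let D0_pos : D0 `<=` `]0, +oo[.
Proof. by move=> t /=; rewrite !in_itv/= andbT => /andP[]. Qed.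

Let D1_pos : D1 `<=` `]0, +oo[.
Proof. by move=> t; rewrite /D1 /= !in_itv/= !andbT => t1; exact: lt_le_trans t1. Qed.

Let mD0 : measurable D0. Proof. exact: measurable_itv. Qed.
Let mD1 : measurable D1. Proof. exact: measurable_itv. Qed.

(* By part_mellinS, near0 and nearoo are what remains of the two halves of the
   integral once the polar parts 1 / y and 1 / (1 - y) are subtracted; they are
   bounded and monotone on ]0, 1[. *)
Let near0 y := fine (part_mellin D0 (y + 1)).
Let nearoo y := fine (part_mellin D1 (y - 1)).

Let c1 s := nonneg_contM (@nonneg_cont_powR R (s - 1)) nonneg_cont_cauchy.

Let part0_le1 y : 0 < y -> (part_mellin D0 (y + 1) <= 1%:E)%E.
Proof.
move=> y0; apply: (@le_trans _ _ (\int[mu]_(t in D0) (t `^ (y + 1 - 1))%:E)%E).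
  apply: le_part_integral => //; first exact: nonneg_cont_powR.
  move=> t /D0_pos /=; rewrite in_itv/= andbT => t0.
  rewrite ler_piMr ?powR_ge0// invf_le1 ?lerDl ?(ltW t0)//.
  by rewrite addr_gt0.
rewrite integral_powR_unit ?addr_gt0// lee_fin invf_le1 ?addr_gt0//.
by rewrite lerDr ltW.
Qed.

Let part1_le1 y : y < 1 -> (part_mellin D1 (y - 1) <= 1%:E)%E.
Proof.
move=> y1; apply: (@le_trans _ _ (\int[mu]_(t in D1) (t `^ (y - 2 - 1))%:E)%E).
  apply: le_part_integral => //; first exact: nonneg_cont_powR.
  move=> t /D1_pos /=; rewrite in_itv/= andbT => t0.
  have -> : t `^ (y - 1 - 1) = t `^ (y - 2 - 1) * t.
    rewrite -[X in _ * X]powRr1 ?(ltW t0)// -powRD; last by rewrite (gt_eqF t0) implybT.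
    by congr (_ `^ _); ring.
  rewrite -mulrA ler_piMr ?powR_ge0// ler_pdivrMr ?mul1r ?lerDr//.
  by rewrite addr_gt0.
rewrite integral_powR_ge1; last by lra.
by rewrite lee_fin invf_le1; lra.
Qed.

Let eqe_subr (u : \bar R) a c : (u + a%:E = c%:E -> u = (c - a)%:E)%E.
Proof. by case: u => [r| |] //= [<-]; rewrite addrK. Qed.

Let near0E y : 0 < y -> part_mellin D0 (y + 1) = (near0 y)%:E.
Proof.
move=> y0; rewrite fineK// ge0_fin_numE; last exact: part_mellin_ge0.
by rewrite (le_lt_trans (part0_le1 y0))// ltry.
Qed.

Let nearooE y : y < 1 -> part_mellin D1 (y - 1) = (nearoo y)%:E.
Proof.
move=> y0; rewrite fineK// ge0_fin_numE; last exact: part_mellin_ge0.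
by rewrite (le_lt_trans (part1_le1 y0))// ltry.
Qed.

Let near0_bound y : 0 < y < 1 -> `|near0 y| <= 1.
Proof.
move=> /andP[y0 _]; rewrite ger0_norm -lee_fin -near0E//; first exact: part0_le1.
exact: part_mellin_ge0.
Qed.

Let nearoo_bound y : 0 < y < 1 -> `|nearoo y| <= 1.
Proof.
move=> /andP[_ y1]; rewrite ger0_norm -lee_fin -nearooE//; first exact: part1_le1.
exact: part_mellin_ge0.
Qed.

Let near0_nincr x y : 0 < x -> x <= y -> y < 1 -> near0 y <= near0 x.
Proof.
move=> x0 xy _; rewrite -lee_fin -!near0E ?(lt_le_trans x0)//.
apply: le_part_integral => // t; rewrite /D0 /= in_itv/= => /andP[t0 t1].
rewrite ler_wpM2r ?invr_ge0 ?addr_ge0 ?(ltW t0)//.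
by apply: ger_powR; rewrite ?t0//; lra.
Qed.

Let nearoo_ndecr x y : 0 < x -> x <= y -> y < 1 -> nearoo x <= nearoo y.
Proof.
move=> _ xy y1; rewrite -lee_fin -!nearooE ?(le_lt_trans xy)//.
apply: le_part_integral => // t; rewrite /D1 /= in_itv/= andbT => t1.
rewrite ler_wpM2r ?invr_ge0 ?addr_ge0 ?(le_trans ler01 t1)//.
by apply: ler_powR => //; lra.
Qed.

Let mellin_cauchy_parts y : 0 < y < 1 ->
  mellin cauchy_ker y = (y^-1 + (1 - y)^-1 - (near0 y + nearoo y))%:E.
Proof.
move=> /andP[y0 y1]; rewrite /mellin halfline_split; last exact: c1.
have := part_mellinS mD0 D0_pos y; rewrite integral_powR_unit// near0E//.
have := part_mellinS mD1 D1_pos (y - 1).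
rewrite integral_powR_ge1; last by rewrite subr_lt0.
rewrite nearooE// subrK -/(part_mellin D0 y) -/(part_mellin D1 y).
rewrite [(_ + part_mellin D1 y)%E]addeC => /eqe_subr -> /eqe_subr ->.
rewrite -EFinD; congr EFin; have -> : - (y - 1) = 1 - y by ring.
by ring.
Qed.

Let J y := fine (mellin cauchy_ker y).

Let D y := J y - pi / sin (pi * y).

Let D_alt_bounded : exists M, alt_bounded D M.
Proof.
pose P : R := pi / 2.
have P0 : 0 < P by rewrite divr_gt0// pi_gt0.
have Pm x : 0 < x < 1 -> 0 < P * x <= pi / 2.
  by move=> /andP[x0 x1]; rewrite mulr_gt0//= ger_pMr// ltW.
have hc x : 0 < x < 1 -> `|P * cot_reg (P * x)| <= P.
  by move=> x01; rewrite normrM (gtr0_norm P0) ger_pMr// cot_reg_bounded// Pm.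
have b1 : alt_bounded (fun x => P * cot_reg (P * x)) (P *+ 2).
  apply: alt_bounded_nincr => // x y x0 xy y1.
  rewrite ler_pM2l//; have y01 : 0 < y < 1 by rewrite (lt_le_trans x0).
  have /andP[_ hy] := Pm _ y01; apply: cot_reg_nincr => //; first exact: mulr_gt0.
  by rewrite ler_pM2l.
have b2 : alt_bounded (fun x => - (P * cot_reg (P * (1 - x)))) (P *+ 2).
  apply: alt_bounded_nincr.
    by move=> x x01; rewrite normrN hc//; lra.
  move=> x y x0 xy y1; rewrite lerN2 ler_pM2l//.
  have x01 : 0 < 1 - x < 1 by lra.
  have /andP[_ hx] := Pm _ x01; apply: cot_reg_nincr => //.
    by rewrite mulr_gt0// subr_gt0.
  by rewrite ler_pM2l// lerD2l lerN2.
have b3 := alt_bounded_nincr near0_bound near0_nincr.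
have b4 : alt_bounded (fun x => - nearoo x) (1 *+ 2).
  apply: alt_bounded_nincr; first by move=> x x01; rewrite normrN nearoo_bound.
  by move=> x y x0 xy y1; rewrite lerN2 nearoo_ndecr.
have := alt_boundedD (alt_boundedD (alt_boundedN b1) b2)
   (alt_boundedD (alt_boundedN b3) b4).
set M := (X in alt_bounded _ X) => h; exists M.
move=> N x x01 xS; apply: le_trans (h N x x01 xS).
rewrite le_eqVlt; apply/orP; left; apply/eqP; congr (`|_|).
apply: eq_big_nat => k /andP[_ kN]; congr (_ * _).
rewrite /D /J mellin_cauchy_parts ?x01//= csc_cot ?x01//.
by rewrite -/P; ring.
Qed.

(* Both sides of the reflection formula satisfy the same trisection relation:
    for the integral it comes from 1 / (1 + t) = (1 - t + t ^ 2) / (1 + t ^ 3) and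
    the substitution t := t ^ 3. *)
Let D_trisection y : 0 < y < 1 ->
  3 * D y = D (y / 3) - D ((y + 1) / 3) + D ((y + 2) / 3).
Proof.
move=> y01; rewrite /D; pose K3 t : R := (1 + t ^+ 3)^-1.
have cube z : mellin cauchy_ker z = (3%:E * mellin K3 (3 * z)%R)%E.
  rewrite (@mellin_subst R cauchy_ker 1 2 z ltr01 nonneg_cont_cauchy) powR1 mulr1.
  by congr (_ * _)%E; apply: eq_mellin => t t0; rewrite mul1r.
have c3 : nonneg_cont K3.
  have := @nonneg_cont_comp R cauchy_ker 1 3 ltr01 nonneg_cont_cauchy.
  by under eq_fun do rewrite mul1r.
have cm k := nonneg_contM (@nonneg_cont_exp R k) c3.
have key : (mellin cauchy_ker y + mellin K3 (y + 1)%R =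
   mellin K3 y + mellin K3 (y + 2)%R)%E.
  rewrite -[in LHS](mellinXM _ 1) -[in RHS](mellinXM _ 2) -!mellinD//; last first.
    exact: nonneg_cont_cauchy.
  apply: eq_mellin => t t0; rewrite /cauchy_ker /K3.
  have h1 : 1 + t != 0 by rewrite gt_eqF// addr_gt0.
  have h3 : 1 + t ^+ 3 != 0 by rewrite gt_eqF// addr_gt0// exprn_gt0.
  by field; rewrite h1 h3.
have fin z : 0 < z < 1 ->
    mellin K3 (3 * z) = (J z / 3)%:E.
  move=> z01; have := cube z; rewrite /J mellin_cauchy_parts//=.
  have := mellin_ge0 (3 * z) c3.
  case: (mellin _ _) => [r| |] //=.
    by rewrite -EFinM => _ [->]; congr EFin; field.
  by rewrite mulry gtr0_sg// mul1e.
have f0 : mellin K3 y = (J (y / 3) / 3)%:E.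
  by rewrite -fin; [congr (mellin _ _); field|lra].
have f1 : mellin K3 (y + 1) = (J ((y + 1) / 3) / 3)%:E.
  by rewrite -fin; [congr (mellin _ _); field|lra].
have f2 : mellin K3 (y + 2) = (J ((y + 2) / 3) / 3)%:E.
  by rewrite -fin; [congr (mellin _ _); field|lra].
have fy : mellin cauchy_ker y = (J y)%:E.
  by rewrite /J mellin_cauchy_parts.
have comb (j0 j1 j2 j3 g1 g2 g3 : R) : j0 + j2 / 3 = j1 / 3 + j3 / 3 ->
    3 * j0 - (g1 - g2 + g3) = j1 - g1 - (j2 - g2) + (j3 - g3) by move=> h; lra.
move: key; rewrite f0 f1 f2 fy -!EFinD => -[h].
rewrite mulrBr csc_trisection//; exact: comb h.
Qed.

(** Euler's reflection integral: the difference of the two sides has bounded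
    alternating sums and satisfies the trisection relation, so it vanishes. *)
Lemma mellin_cauchy y : 0 < y < 1 -> mellin cauchy_ker y = (pi / sin (pi * y))%:E.
Proof.
move=> y01; have [M hM] := D_alt_bounded.
have := trisection_eq0 hM D_trisection y01.
rewrite /D /J => /eqP; rewrite subr_eq0 => /eqP <-.
by rewrite mellin_cauchy_parts.
Qed.

End Reflection.

(** * Mellin transform of an infinite product *)

Section QGamma.
Variables (R : realType) (p : R).
Hypotheses (p0 : 0 < p) (p1 : p < 1).
Local Notation mu := (@lebesgue_measure R).
Implicit Types (x y t z : R) (n : nat).

Definition qexp_trunc n t : R := (qpoch (- t) p n)^-1.

(** One of the two q-analogues of exp (- t), up to normalization. *)
Definition qexp t : R := (qpoch_inf (- t) p)^-1.

Lemma nonneg_cont_qpoch n : nonneg_cont (fun t => qpoch (- t) p n).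
Proof.
elim: n => [|n IH].
  by under eq_fun do rewrite qpoch0; exact: nonneg_cont_cst.
under eq_fun do rewrite qpochS mulNr opprK [_ * p ^+ n]mulrC.
apply: nonneg_contM => //; apply: nonneg_cont_affine => //.
by rewrite exprn_ge0// ltW.
Qed.

Lemma nonneg_cont_qexp_trunc n : nonneg_cont (qexp_trunc n).
Proof.
apply: nonneg_contV; first exact: nonneg_cont_qpoch.
by move=> t t0; rewrite (lt_le_trans ltr01)// qpoch_le0_ge1// oppr_le0 ltW.
Qed.

Lemma cvg_qexp_trunc t : 0 <= t -> (fun n => qexp_trunc n t) @ \oo --> qexp t.
Proof.
move=> t0; have h : 1 <= qpoch_inf (- t) p by rewrite qpoch_inf_ge1// oppr_le0.
apply: cvgV; last exact: cvg_qpoch.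
by rewrite gt_eqF// (lt_le_trans ltr01).
Qed.

Lemma qexp_trunc_ge0 n t : 0 <= t -> 0 <= qexp_trunc n t.
Proof.
by move=> t0; rewrite invr_ge0 (le_trans ler01)// qpoch_le0_ge1// oppr_le0.
Qed.

Lemma qexp_truncS n t : qexp_trunc n.+1 t = qexp_trunc n t * (1 + t * p ^+ n)^-1.
Proof. by rewrite /qexp_trunc qpochS mulNr opprK invfM. Qed.

Lemma qexp_trunc_le1 n t : 0 <= t -> qexp_trunc n t <= 1.
Proof.
move=> t0; have h := qpoch_le0_ge1 p0 n (eqbRL (oppr_le0 t) t0).
by rewrite invf_le1// (lt_le_trans ltr01).
Qed.

Lemma qexp_trunc_nincr t : 0 <= t -> nonincreasing_seq (qexp_trunc ^~ t).
Proof.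
move=> t0; apply/nonincreasing_seqP => n; rewrite qexp_truncS.
have h : 0 <= t * p ^+ n by rewrite mulr_ge0// exprn_ge0// ltW.
by rewrite ler_piMr ?qexp_trunc_ge0// invf_le1 ?lerDl// ltr_pwDl.
Qed.

(** The factors 1 / (1 + t p ^ k) take values in ]0, 1] and are p ^ k-Lipschitz,
    so the Lipschitz constant of their product is at most 1 / (1 - p). *)
Lemma qexp_trunc_lipschitz n x y : 0 <= x -> 0 <= y ->
  `|qexp_trunc n x - qexp_trunc n y| <= (1 - p)^-1 * `|x - y|.
Proof.
move=> x0 y0.
apply: (@le_trans _ _ ((\sum_(0 <= k < n) p ^+ k) * `|x - y|)); last first.
  rewrite ler_wpM2r// -[leRHS]mul1r ler_pdivlMr ?subr_gt0//.
  suff -> : (\sum_(0 <= k < n) p ^+ k) * (1 - p) = 1 - p ^+ n.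
    by rewrite gerBl exprn_ge0// ltW.
  elim: n => [|n IH]; first by rewrite big_nil expr0 mul0r subrr.
  by rewrite big_nat_recr//= mulrDl IH exprS; ring.
elim: n => [|n IH].
  by rewrite /qexp_trunc !qpoch0 subrr normr0 big_nil mul0r.
rewrite !qexp_truncS big_nat_recr//= mulrDl.
set a := qexp_trunc n x; set b := qexp_trunc n y.
set c := (1 + x * p ^+ n)^-1; set d := (1 + y * p ^+ n)^-1.
have pn0 : 0 <= p ^+ n by rewrite exprn_ge0// ltW.
have hx : 1 <= 1 + x * p ^+ n by rewrite lerDl mulr_ge0.
have hy : 1 <= 1 + y * p ^+ n by rewrite lerDl mulr_ge0.
have hx0 := lt_le_trans ltr01 hx; have hy0 := lt_le_trans ltr01 hy.
have c0 : 0 <= c by rewrite /c invr_ge0 ltW.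
have c1 : c <= 1 by rewrite /c invf_le1.
have d0 : 0 <= d by rewrite /d invr_ge0 ltW.
have d1 : d <= 1 by rewrite /d invf_le1.
have b0 : 0 <= b by exact: qexp_trunc_ge0.
have b1 : b <= 1 by exact: qexp_trunc_le1.
have -> : a * c - b * d = (a - b) * c + b * (c - d) by ring.
rewrite (le_trans (ler_normD _ _))// lerD//.
  by rewrite normrM (le_trans _ IH)// ler_piMr// ger0_norm.
have -> : c - d = (y - x) * p ^+ n * (c * d).
  by rewrite /c /d; field; rewrite !gt_eqF.
rewrite !normrM distrC (ger0_norm b0) (ger0_norm c0) (ger0_norm d0) (ger0_norm pn0).
set e := `|_ - _|; have -> : b * (e * p ^+ n * (c * d)) = p ^+ n * e * (b * (c * d)) by ring.
have e0 : 0 <= e by exact: normr_ge0.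
have bcd : b * (c * d) <= 1 by rewrite !mulr_ile1 ?mulr_ge0.
by rewrite ler_piMr ?mulr_ge0.
Qed.

(** Passing to the limit in the Lipschitz bound yields the continuity of the
    infinite product without any uniform convergence argument. *)
Lemma qexp_lipschitz x y : 0 <= x -> 0 <= y ->
  `|qexp x - qexp y| <= (1 - p)^-1 * `|x - y|.
Proof.
move=> x0 y0; have h : (fun n => `|qexp_trunc n x - qexp_trunc n y|) @ \oo -->
    `|qexp x - qexp y|.
  by apply: cvg_norm; apply: cvgB; exact: cvg_qexp_trunc.
by apply: (cvg_le_cst h (N := 0)) => n _; exact: qexp_trunc_lipschitz.
Qed.

Lemma nonneg_cont_qexp : nonneg_cont qexp.
Proof.
move=> t t0; split; last first.
  by rewrite invr_ge0 (le_trans ler01)// qpoch_inf_ge1// oppr_le0 ltW.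
apply/cvgrPdist_lt => /= e e0; near=> x.
have x0 : 0 < x by near: x; exact: lt_nbhsr.
rewrite (le_lt_trans (qexp_lipschitz (ltW t0) (ltW x0)))//.
rewrite mulrC ltr_pdivrMr ?subr_gt0//.
near: x; apply: cvgr_dist_lt; last by rewrite mulr_gt0// subr_gt0.
exact: cvg_id.
Unshelve. all: by end_near. Qed.

Lemma qexp_trunc_rec n t : 0 <= t ->
  qexp_trunc n t = (1 - p ^+ n) * qexp_trunc n.+1 t + p ^+ n * qexp_trunc n (p * t).
Proof.
move=> t0; have pn0 : 0 <= p ^+ n by rewrite exprn_ge0// ltW.
have -> : qexp_trunc n (p * t) = (1 + t) * qexp_trunc n.+1 t.
  rewrite /qexp_trunc qpochSl opprK mulNr [t * p]mulrC invfM mulVKf//.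
  by rewrite gt_eqF// ltr_pwDl.
rewrite qexp_truncS; field.
by rewrite gt_eqF// ltr_pwDl// mulr_ge0.
Qed.

Lemma qexp_rec t : 0 <= t -> qexp (p * t) = qexp t + t * qexp t.
Proof.
move=> t0; have h : 1 + t != 0 by rewrite gt_eqF// ltr_pwDl.
rewrite /qexp (qpoch_inf_shift p0 p1 (- t) 1) expr1 mulNr [t * p]mulrC.
rewrite qpochS qpoch0 mul1r expr0 mulr1 opprK invfM.
by move: (qpoch_inf _ _)^-1 => u; field.
Qed.

Lemma powR_expS n y : p ^+ n * p `^ (- y) = p `^ (n%:R - y).
Proof. by rewrite -powR_mulrn ?(ltW p0)// -powRD// (gt_eqF p0) implybT. Qed.

(** Separating the extreme factors of the truncated product, the Mellin
    transforms satisfy a first-order recurrence in the length. *)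
Lemma mellin_qexp_trunc_rec n y m : (0 < n)%N ->
  mellin (qexp_trunc n) y = m%:E ->
  mellin (qexp_trunc n.+1) y = (m * (1 - p `^ (n%:R - y)) / (1 - p ^+ n))%:E.
Proof.
move=> n0 mE; have pn1 : 0 < 1 - p ^+ n by rewrite subr_gt0 exprn_ilt1 ?ltW// -lt0n.
have c1 := nonneg_cont_qexp_trunc.
have : mellin (qexp_trunc n) y = ((1 - p ^+ n)%:E * mellin (qexp_trunc n.+1) y
    + (p ^+ n)%:E * ((p `^ (- y))%:E * mellin (qexp_trunc n) y))%E.
  have c2 : nonneg_cont (fun t => qexp_trunc n (p * t)).
    by have := @nonneg_cont_comp _ _ p 1 p0 (c1 n); under eq_fun do rewrite expr1.
  have q0 : 0 <= p ^+ n by rewrite exprn_ge0// ltW.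
  rewrite -(mellin_scale _ p0 (c1 n)) -!mellinZ//; last exact: ltW.
  rewrite -mellinD//; last 2 first.
  - by apply: nonneg_contM => //; apply: nonneg_cont_cst; exact: ltW.
  - by apply: nonneg_contM => //; apply: nonneg_cont_cst.
  by apply: eq_mellin => t t0; apply: qexp_trunc_rec; exact: ltW.
rewrite mE -!EFinM mulrA powR_expS.
have := mellin_ge0 y (c1 n.+1).
case: (mellin (qexp_trunc n.+1) y) => [r| |] //= _.
  rewrite -EFinM -EFinD => -[h]; congr EFin.
  have -> : m * (1 - p `^ (n%:R - y)) = r * (1 - p ^+ n) by lra.
  by rewrite mulfK// gt_eqF.
by rewrite mulry gtr0_sg// mul1e.
Qed.

(** The truncations decrease with their length, so that any of them with a
    finite transform dominates the following ones. *)
Lemma cvg_mellin_qexp_trunc N y : (mellin (qexp_trunc N) y < +oo)%E ->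
  (fun n => mellin (qexp_trunc n) y) @ \oo --> mellin qexp y.
Proof.
move=> fin.
have c0 n := nonneg_cont_mellin y (nonneg_cont_qexp_trunc n).
have ce := nonneg_cont_mellin y nonneg_cont_qexp.
rewrite -(cvg_shiftn N)/=.
pose f (n : nat) t := (t `^ (y - 1) * qexp_trunc (n + N) t)%:E.
have [|||_ _] := @dominated_convergence _ _ _ mu `]0, +oo[%classic
  (measurable_itv _) f (fun t => (t `^ (y - 1) * qexp t)%:E)
  (fun t => (t `^ (y - 1) * qexp_trunc N t)%:E)
  (fun n => nonneg_cont_emeasurable (c0 (n + N)%N))
  (nonneg_cont_emeasurable ce); last by apply.
- apply: aeW => t /=; rewrite in_itv/= andbT => t0.
  apply: cvg_EFin; first exact: nearW.
  apply: cvgM; first exact: cvg_cst.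
  by rewrite (cvg_shiftn N (qexp_trunc ^~ t)); exact/cvg_qexp_trunc/ltW.
- apply/integrableP; split; first exact: nonneg_cont_emeasurable (c0 N).
  rewrite [X in (X < _)%E](_ : _ = mellin (qexp_trunc N) y)//.
  apply: eq_integral => t; rewrite inE/= in_itv/= andbT => t0.
  by rewrite ger0_norm//; exact: (c0 N t t0).2.
- apply: aeW => t n /=; rewrite in_itv/= andbT => t0.
  rewrite lee_fin ger0_norm; last exact: (c0 (n + N)%N t t0).2.
  rewrite ler_wpM2l ?powR_ge0//.
  by apply: (qexp_trunc_nincr (ltW t0)); exact: leq_addl.
Qed.

(** Mellin transform of the functional equation qexp (p t) = (1 + t) qexp t. *)
Lemma mellin_qexp_shift y m : mellin qexp y = m%:E ->
  mellin qexp (y + 1) = ((p `^ (- y) - 1) * m)%:E.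
Proof.
move=> mE; have ce := nonneg_cont_qexp.
have : ((p `^ (- y))%:E * mellin qexp y = mellin qexp y + mellin qexp (y + 1))%E.
  rewrite -(mellin_scale y p0 ce) -(mellinXM qexp 1) -mellinD//; last first.
    by apply: nonneg_contM => //; exact: nonneg_cont_exp.
  by apply: eq_mellin => t t0; rewrite expr1 qexp_rec// ltW.
rewrite mE -EFinM; case: (mellin qexp (y + 1)) => [r| |] //=.
by rewrite -EFinD => -[h]; congr EFin; rewrite mulrBl mul1r h; ring.
Qed.

Lemma mellin_qexp_small y : 0 < y < 1 -> mellin qexp y =
  (pi / sin (pi * y) * (qpoch_inf (p `^ (1 - y)) p / qpoch_inf p p))%:E.
Proof.
move=> y01.
have trunc n : mellin (qexp_trunc n.+1) y =
    (pi / sin (pi * y) * (qpoch (p `^ (1 - y)) p n / qpoch p p n))%:E.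
  elim: n => [|n IH].
    rewrite !qpoch0 divr1 mulr1 -(mellin_cauchy y01); apply: eq_mellin => t t0.
    by rewrite /qexp_trunc qpochS qpoch0 mul1r expr0 mulr1 opprK.
  rewrite (mellin_qexp_trunc_rec _ IH)//; congr EFin.
  have -> : p `^ (n.+1%:R - y) = p `^ (1 - y) * p ^+ n.
    rewrite -[in RHS]powR_mulrn ?(ltW p0)// -powRD; last by rewrite (gt_eqF p0) implybT.
    by congr (_ `^ _); rewrite -natr1; ring.
  by rewrite !qpochS -exprS invfM; ring.
have h := @cvg_mellin_qexp_trunc 1 y; rewrite trunc ltry in h.
have {}h := h isT; rewrite -cvg_shiftS/= in h.
have h2 : (fun n => mellin (qexp_trunc n.+1) y) =
  (fun n => (pi / sin (pi * y) * (qpoch (p `^ (1 - y)) p n / qpoch p p n))%:E).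
  by apply/funext => n; exact: trunc.
rewrite h2 in h; apply: (cvg_unique _ h) => //=.
apply: cvg_EFin; first exact: nearW.
apply: cvgM; first exact: cvg_cst.
apply: cvgM; first exact: cvg_qpoch.
apply: cvgV; last exact: cvg_qpoch.
by rewrite gt_eqF// qpoch_inf_gt0.
Qed.

(** At y = 1 the transform of the first truncation 1 / (1 + t) diverges, and the
    recurrence starts from 1 / ((1 + t) (1 + p t)), which has the primitive
    (ln (1 + t) - ln (1 + p t)) / (1 - p). *)
Lemma mellin_qexp_trunc2 : mellin (qexp_trunc 2) 1 = (ln p^-1 / (1 - p))%:E.
Proof.
have p10 : 0 < 1 - p by rewrite subr_gt0.
have eE t : qexp_trunc 2 t = ((1 + t) * (1 + t * p))^-1.
  by rewrite /qexp_trunc !qpochS qpoch0 mul1r expr0 expr1 mulr1 mulNr !opprK.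
pose F t := (ln (1 + t) - ln (1 + p * t)) / (1 - p).
have cG := nonneg_cont_mellin 1 (nonneg_cont_qexp_trunc 2).
have dF t : 0 < t -> is_derive t (1 : R) F (t `^ (1 - 1) * qexp_trunc 2 t).
  move=> t0; rewrite subrr powRr0 mul1r eE.
  have h1 : 0 < 1 + t by rewrite addr_gt0.
  have h2 : 0 < 1 + p * t by rewrite addr_gt0// mulr_gt0.
  have d1 : is_derive t (1 : R) (fun x => ln (1 + x)) (1 + t)^-1.
    have hh : is_derive t (1 : R) (fun x : R => 1 + x) 1.
      have hD : is_derive t (1 : R) (cst (1 : R) + (@id R : R -> R)) (0 + 1).
        exact: is_deriveD.
      by apply: (is_derive_eq hD); rewrite add0r.
    apply: (is_derive_eq (is_derive1_comp (is_derive1_ln h1) hh)).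
    by rewrite mulr1.
  have d2 : is_derive t (1 : R) (fun x => ln (1 + p * x)) ((1 + p * t)^-1 * p).
    have hh : is_derive t (1 : R) (fun x : R => 1 + p * x) p.
      have hD : is_derive t (1 : R) (cst (1 : R) + (p \*: (@id R : R -> R))) (0 + p *: 1).
        exact: is_deriveD.
      by apply: (is_derive_eq hD); rewrite add0r /GRing.scale/= mulr1.
    exact: (@is_derive1_comp R (@ln R) (fun x => 1 + p * x) t _ _ (is_derive1_ln h2) hh).
  have -> : F = (1 - p)^-1 \*: ((fun x => ln (1 + x)) - (fun x => ln (1 + p * x))).
    by apply/funext => x; rewrite /F mulrC.
  apply: (is_derive_eq (is_deriveZ (1 - p)^-1 (is_deriveB d1 d2))).
  rewrite /GRing.scale/=; field.
  by rewrite !gt_eqF// mulrC.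
have cl c : 0 < c -> (fun n => ln (c + itv_lo R n)) @ \oo --> ln c.
  move=> c0; apply: continuous_cvg; first exact: continuous_ln.
  suff : (fun n => c + itv_lo R n) @ \oo --> c + 0 by rewrite addr0.
  by apply: cvgD; [exact: cvg_cst|exact: cvg_itv_lo].
rewrite /mellin (@integral_exhaust_FTC R _ F (itv_lo R) (itv_hi R) _ 0
   ((ln 1 - ln p) / (1 - p)) cG dF).
- by rewrite subr0 ln1 sub0r lnV.
- exact: itv_lo_gt0.
- by move=> n; rewrite (le_trans (itv_lo_le1 _ _))// itv_hi_ge1.
- exact: itv_lo_nincr.
- exact: itv_hi_ndecr.
- apply: halfline_bigcup; [exact: itv_lo_gt0|exact: inv_le_halfline].
- have -> : 0 = (ln (1 + 0) - ln (1 + p * 0)) / (1 - p) :> R.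
    by rewrite mulr0 subrr mul0r.
  apply: cvgM; last exact: cvg_cst.
  apply: cvgB; apply: continuous_cvg; rewrite ?mulr0 ?addr0.
  + exact: continuous_ln.
  + suff : (fun n => 1 + itv_lo R n) @ \oo --> (1 : R) + 0 by rewrite addr0.
    by apply: cvgD; [exact: cvg_cst|exact: cvg_itv_lo].
  + exact: continuous_ln.
  + suff : (fun n => 1 + p * itv_lo R n) @ \oo --> (1 : R) + p * 0 by rewrite mulr0 addr0.
    apply: cvgD; first exact: cvg_cst.
    by apply: cvgM; [exact: cvg_cst|exact: cvg_itv_lo].
- (* 1 + t = t (1 + 1 / t) and 1 + p t = t (p + 1 / t) *)
  suff -> : F \o itv_hi R =
      (fun n => (ln (1 + itv_lo R n) - ln (p + itv_lo R n)) / (1 - p)).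
    by apply: cvgM; [apply: cvgB; exact: cl|exact: cvg_cst].
  apply/funext => n; rewrite /F/=; congr (_ / _).
  have hn : 0 < itv_hi R n by rewrite ltr0n.
  have ln0 := itv_lo_gt0 R n.
  have -> : 1 + itv_hi R n = itv_hi R n * (1 + itv_lo R n).
    by rewrite /itv_lo -/(itv_hi R n); field; rewrite gt_eqF.
  have -> : 1 + p * itv_hi R n = itv_hi R n * (p + itv_lo R n).
    by rewrite /itv_lo -/(itv_hi R n); field; rewrite gt_eqF.
  rewrite !lnM ?posrE ?addr_gt0//; ring.
Qed.

(** At y = 1 the recurrence makes (1 - p ^ n) times the n-th integral constant. *)
Lemma mellin_qexp1 : mellin qexp 1 = (ln p^-1)%:E.
Proof.
have pn1 n : 1 - p ^+ n.+1 != 0.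
  by rewrite gt_eqF// subr_gt0 exprn_ilt1// ltW.
have trunc n : mellin (qexp_trunc n.+2) 1 = (ln p^-1 / (1 - p ^+ n.+1))%:E.
  elim: n => [|n IH]; first by rewrite expr1 mellin_qexp_trunc2.
  rewrite (mellin_qexp_trunc_rec _ IH)//; congr EFin.
  have -> : p `^ (n.+2%:R - 1) = p ^+ n.+1.
    rewrite -[RHS]powR_mulrn ?(ltW p0)//; congr (_ `^ _).
    by rewrite -[in LHS]natr1; ring.
  by rewrite mulfVK.
have h := @cvg_mellin_qexp_trunc 2 1; rewrite trunc ltry in h.
have {}h := h isT; rewrite -(cvg_shiftn 2)/= in h.
have h2 : (fun n => mellin (qexp_trunc (n + 2)) 1) =
    (fun n => (ln p^-1 / (1 - p ^+ n.+1))%:E).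
  by apply/funext => n; rewrite addn2.
rewrite h2 in h; apply: (cvg_unique _ h) => //=.
apply: cvg_EFin; first exact: nearW.
suff : (fun n => ln p^-1 / (1 - p ^+ n.+1)) @ \oo --> ln p^-1 / (1 - 0).
  by rewrite subr0 divr1.
apply: cvgM; first exact: cvg_cst.
apply: cvgV; first by rewrite subr0.
apply: cvgB; first exact: cvg_cst.
rewrite (cvg_shiftS (fun n => p ^+ n)).
by apply: cvg_expr; rewrite gtr0_norm.
Qed.

Lemma mellin_qexp_nat m : mellin qexp m.+1%:R =
  ((- p) ^+ m.+1 / (1 - p ^+ m.+1) * qpoch p^-1 p^-1 m.+1 * ln p^-1)%:E.
Proof.
have pn1 n : 1 - p ^+ n.+1 != 0.
  by rewrite gt_eqF// subr_gt0 exprn_ilt1// ltW.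
have pn0 : p != 0 by rewrite gt_eqF.
elim: m => [|m IH].
  rewrite mellin_qexp1 qpochS qpoch0 expr1 expr0; congr EFin.
  have := pn1 0; rewrite expr1 => h.
  by move: (ln _) => L; field; rewrite h pn0.
rewrite -natr1 (mellin_qexp_shift IH); congr EFin.
have -> : p `^ (- m.+1%:R) = p ^- m.+1 by rewrite powRN powR_mulrn// ltW.
rewrite [in RHS]qpochS.
have -> : 1 - p^-1 * p^-1 ^+ m.+1 = - (1 - p ^+ m.+2) / p ^+ m.+2.
  rewrite -exprS exprVn; move: (pn1 m.+1); set P := p ^+ m.+2 => P1.
  by field; rewrite expf_neq0.
have -> : p ^- m.+1 - 1 = (1 - p ^+ m.+1) / p ^+ m.+1.
  by field; rewrite expf_neq0.
have h1 := pn1 m; have h2 := pn1 m.+1.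
have h3 : p ^+ m.+1 != 0 by rewrite expf_neq0.
rewrite [(- p) ^+ m.+2]exprS; move: h2; rewrite [p ^+ m.+2]exprS.
move: (p ^+ m.+1) ((- p) ^+ m.+1) (qpoch _ _ _) (ln _) h1 h3 => P A Q L h1 h3 h2.
by field; rewrite h1 h3 h2 pn0.
Qed.

Lemma mellin_qexp_frac z m : 0 < z < 1 -> mellin qexp (z + m%:R) =
  (pi / sin (pi * (z + m%:R))
     * (qpoch_inf (p `^ (1 - (z + m%:R))) p / qpoch_inf p p))%:E.
Proof.
move=> z01; elim: m => [|m IH]; first by rewrite addr0 mellin_qexp_small.
rewrite -natr1 addrA (mellin_qexp_shift IH); congr EFin.
set y := z + m%:R; have -> : 1 - (y + 1) = - y by ring.
rewrite (qpoch_inf_shift p0 p1 (p `^ (- y)) 1) qpochS qpoch0 mul1r expr0 mulr1 expr1.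
have -> : p `^ (- y) * p = p `^ (1 - y).
  rewrite -[X in _ * X](powRr1 (ltW p0)) -powRD; last by rewrite (gt_eqF p0) implybT.
  by congr (_ `^ _); ring.
have -> : pi * (y + 1) = pi * y + pi by rewrite mulrDr mulr1.
rewrite sinDpi invrN.
by move: (pi : R) (sin _)^-1 (qpoch_inf p p)^-1 => P S Q; ring.
Qed.

(** Both cases of the closed form follow from the values on ]0, 1] by the
    shift y := y + 1, which turns (p ^ (1 - y); p)_oo / sin (pi y) into itself times
    p ^ (- y) - 1. *)
Lemma mellin_qexp y : 0 < y -> mellin qexp y = (qgamma_integral_value p 0 y)%:E.
Proof.
move=> y0; rewrite /qgamma_integral_value !mul0r.
have q1 n : qpoch 0 p^-1 n = 1 :> R by rewrite /qpoch big1// => k _; rewrite mul0r subr0.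
have q2 : qpoch_inf 0 p = 1.
  by rewrite /qpoch_inf; apply: cvg_lim => //; under eq_fun do
    (rewrite big1; [|by move=> k _; rewrite mul0r subr0]); exact: cvg_cst.
case: ifPn => [/natrP[[|m] yE]|yN].
- by rewrite yE ltxx in y0.
- by rewrite {1}yE mellin_qexp_nat yE natrK q1 divr1.
- rewrite q2 divr1 mulr1; pose m := Num.truncn y.
  have /andP[h1 h2] := truncn_itv (ltW y0).
  have -> : y = (y - m%:R) + m%:R by rewrite subrK.
  apply: mellin_qexp_frac; rewrite subr_gt0 ltrBlDl natr1 h2 andbT.
  rewrite lt_neqAle h1 andbT; apply: contraNneq yN => <-.
  exact: natr_nat.
Qed.

Lemma powR_lt1 x : 0 < x -> p `^ x < 1.
Proof.
by move=> x0; rewrite /powR (gt_eqF p0) expR_lt1 pmulr_rlt0// ln_lt0// p0.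
Qed.

(** Positivity is read off the values on ]0, 1] and propagates through the
    positive factors p ^ (- y) - 1 of the shift. *)
Lemma qgamma_integral_gt0 y : 0 < y -> 0 < qgamma_integral_value p 0 y.
Proof.
move=> y0; rewrite -lte_fin -mellin_qexp//.
have shift x m : 0 < x -> (0 < mellin qexp x)%E -> (0 < mellin qexp (x + m%:R))%E.
  move=> x0 hx; elim: m => [|m IH]; first by rewrite addr0.
  have xm : 0 < x + m%:R by rewrite ltr_pwDl.
  rewrite -natr1 addrA (mellin_qexp_shift (mellin_qexp xm)) lte_fin.
  rewrite mellin_qexp// lte_fin in IH; rewrite mulr_gt0// subr_gt0.
  by rewrite powRN invf_gt1 ?powR_gt0// powR_lt1.
pose m := Num.truncn y; have /andP[h1 h2] := truncn_itv (ltW y0).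
have yE : y = (y - m%:R) + m%:R by rewrite subrK.
have [ym|ym] := eqVneq y m%:R.
  have m0 : (0 < m)%N by rewrite -(ltr0n R) -ym.
  rewrite ym -(prednK m0) -natr1 addrC; apply: shift => //.
  by rewrite mellin_qexp1 lte_fin ln_gt0// invf_gt1.
have z01 : 0 < y - m%:R < 1.
  by rewrite subr_gt0 ltrBlDl natr1 h2 andbT lt_neqAle eq_sym ym.
have /andP[z0 z1] := z01; rewrite yE; apply: shift => //.
rewrite mellin_qexp_small// lte_fin mulr_gt0 ?divr_gt0 ?qpoch_inf_gt0//.
- by rewrite pi_gt0.
- by rewrite sin_gt0_pi// mulr_gt0 ?pi_gt0//= gtr_pMr ?pi_gt0.
- by rewrite powR_lt1// subr_gt0.
Qed.

End QGamma.

(** * Moments of the symmetric weight *)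

Section Parity.
Variable R : realType.
Local Notation mu := (@lebesgue_measure R).
Implicit Types f : R -> R.

(** Reduces integrals over the line to the half-line, for functions that may
    be discontinuous at 0. *)
Lemma ge0_integral_split0 (f : R -> \bar R) : measurable_fun setT f ->
  (forall x, (0 <= f x)%E) ->
  (\int[mu]_x f x = \int[mu]_(x in `]0%R, +oo[) f (- x)%R + \int[mu]_(x in `]0%R, +oo[) f x)%E.
Proof.
move=> mf f0.
have E : [set: R] = `]-oo, 0] `|` `]0, +oo[.
  apply/seteqP; split => // t _ /=; rewrite !in_itv/= andbT.
  by have [h|h] := leP t 0; [left|right].
rewrite [in LHS]E ge0_integral_setU//; last 2 first.
- by rewrite -E.
- rewrite disj_set2E; apply/eqP/seteqP; split => // t [] /=; rewrite !in_itv/=.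
  by move=> h; rewrite andbT ltNge h.
congr (_ + _)%E.
have mfN : measurable_fun setT (f \o (-%R : R -> R)).
  by apply: measurableT_comp => //; exact: oppr_measurable.
rewrite integral_itv_obnd_cbnd; last exact: measurable_funS mfN.
rewrite (ge0_integration_by_substitution0 mfN)//=.
by apply: eq_integral => x _; rewrite opprK.
Qed.

End Parity.

Section Weight.
Variables (R : realType) (p b y : R).
Hypotheses (p0 : 0 < p) (p1 : p < 1) (b0 : 0 < b) (y0 : 0 < y).
Local Notation mu := (@lebesgue_measure R).
Local Notation I := (qgamma_integral_value p 0).
Implicit Types (x t z : R) (n i : nat).

Definition sym_weight x : R := `|x| `^ (2 * y - 1) * qexp p (b^-1 * x ^+ 2).

Lemma mellin_qexp_scale z : 0 < z ->
  mellin (fun t => qexp p (b^-1 * t)) z = (b `^ z * I z)%:E.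
Proof.
move=> z0; have bV0 : 0 < b^-1 by rewrite invr_gt0.
rewrite mellin_scale//; last exact: nonneg_cont_qexp.
rewrite mellin_qexp// -EFinM; congr (_ * _)%:E.
by rewrite -powR_inv1 ?(ltW b0)// -powRrM mulN1r opprK.
Qed.

Lemma mellin_qexp_sqr z : 0 < z ->
  mellin (fun t => qexp p (b^-1 * t ^+ 2)) (2 * z) = (2^-1 * (b `^ z * I z))%:E.
Proof.
move=> z0; have bV0 : 0 < b^-1 by rewrite invr_gt0.
have := @mellin_subst R _ b^-1 1 z bV0 (nonneg_cont_qexp p0 p1).
rewrite mellin_qexp//.
have -> : b^-1 `^ z = (b `^ z)^-1.
  by rewrite -powR_inv1 ?(ltW b0)// -powRrM mulN1r powRN.
have bz : 0 < b `^ z by rewrite powR_gt0.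
have := mellin_ge0 (2 * z) (nonneg_cont_comp 2 bV0 (nonneg_cont_qexp p0 p1)).
case: (mellin _ (2 * z)) => [r| |] //= _.
  rewrite -EFinM => -[->]; congr EFin; field.
  by rewrite gt_eqF.
by rewrite mulry gtr0_sg ?mul1e// mulr_gt0 ?invr_gt0.
Qed.

Lemma sym_weight_ge0 x : 0 <= sym_weight x.
Proof.
rewrite mulr_ge0 ?powR_ge0// invr_ge0 (le_trans ler01)// qpoch_inf_ge1//.
by rewrite oppr_le0 mulr_ge0 ?sqr_ge0// invr_ge0 ltW.
Qed.

Lemma sym_weightN x : sym_weight (- x) = sym_weight x.
Proof. by rewrite /sym_weight normrN sqrrN. Qed.

Lemma measurable_sym_weight : measurable_fun setT sym_weight.
Proof.
apply: measurable_funM.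
  apply: measurableT_comp (measurable_powR _) _.
  exact: normr_measurable.
apply: continuous_measurable_fun => x.
apply/cvgrPdist_lt => /= e e0; near=> t.
have sq0 s : 0 <= b^-1 * s ^+ 2 by rewrite mulr_ge0 ?sqr_ge0// invr_ge0 ltW.
rewrite (le_lt_trans (qexp_lipschitz p0 p1 (sq0 x) (sq0 t)))//.
rewrite mulrC ltr_pdivrMr ?subr_gt0//; near: t.
by move: (@continuous_monomial R b^-1 2 x) => /cvgrPdist_lt; apply;
  rewrite mulr_gt0// subr_gt0.
Unshelve. all: by end_near. Qed.

Lemma measurable_sym_weightX i : measurable_fun setT (fun x => sym_weight x * x ^+ i).
Proof. by apply: measurable_funM; [exact: measurable_sym_weight|exact: exprn_measurable]. Qed.

Lemma integral_sym_weight_half i :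
  (\int[mu]_(x in `]0%R, +oo[) (sym_weight x * x ^+ i)%:E =
   (2^-1 * (b `^ (y + i%:R / 2) * I (y + i%:R / 2)))%:E)%E.
Proof.
rewrite -mellin_qexp_sqr ?ltr_pwDl ?divr_ge0//.
apply: eq_integral => t; rewrite inE/= in_itv/= andbT => t0; congr EFin.
rewrite /sym_weight gtr0_norm// mulrAC -powR_mulrn ?(ltW t0)//.
rewrite -powRD; last by rewrite (gt_eqF t0) implybT.
by congr (_ `^ _ * _); field.
Qed.

Lemma sym_weight_integrable i :
  mu.-integrable setT (EFin \o (fun x => sym_weight x * x ^+ i)).
Proof.
have mw := measurable_sym_weightX i.
apply/integrableP; split; first by apply/measurable_EFinP; exact: mw.
rewrite ge0_integral_split0//; last first.
  have mwE : measurable_fun setT (EFin \o (fun x => sym_weight x * x ^+ i)).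
    by apply/measurable_EFinP; exact: mw.
  exact: (measurableT_comp (@abse_measurable R setT) mwE).
have E x : 0 < x -> `|sym_weight x * x ^+ i| = sym_weight x * x ^+ i.
  by move=> x0; rewrite ger0_norm// mulr_ge0 ?sym_weight_ge0// exprn_ge0// ltW.
rewrite [X in (X + _)%E](_ : _ =
    \int[mu]_(x in `]0%R, +oo[) (sym_weight x * x ^+ i)%:E)%E; last first.
  apply: eq_integral => t; rewrite inE/= in_itv/= andbT => t0.
  by rewrite -(E t t0) /= sym_weightN !normrM !normrX normrN.
rewrite [X in (_ + X)%E](_ : _ =
    \int[mu]_(x in `]0%R, +oo[) (sym_weight x * x ^+ i)%:E)%E; last first.
  by apply: eq_integral => t; rewrite inE/= in_itv/= andbT => t0; rewrite -[in RHS](E t t0).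
by rewrite integral_sym_weight_half -EFinD ltry.
Qed.

Lemma sym_weight_moment_even n :
  Rintegral mu setT (fun x => sym_weight x * x ^+ n.*2) =
  b `^ (y + n%:R) * I (y + n%:R).
Proof.
have e0 x : 0 <= x ^+ n.*2 by rewrite -mul2n exprM exprn_ge0// sqr_ge0.
rewrite /Rintegral ge0_integral_split0; last 2 first.
- by apply/measurable_EFinP; exact: measurable_sym_weightX.
- by move=> x; rewrite lee_fin mulr_ge0 ?sym_weight_ge0.
rewrite [X in (X + _)%E](_ : _ =
    \int[mu]_(x in `]0%R, +oo[) (sym_weight x * x ^+ n.*2)%:E)%E; last first.
  by apply: eq_integral => t _; rewrite sym_weightN -mul2n !exprM sqrrN.
rewrite integral_sym_weight_half -EFinD /=.
have -> : n.*2%:R / 2 = n%:R :> R by rewrite -muln2 natrM mulfK.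
by field.
Qed.

Lemma sym_weight_moment_odd n :
  Rintegral mu setT (fun x => sym_weight x * x ^+ n.*2.+1) = 0.
Proof.
have mw := measurable_sym_weightX n.*2.+1.
rewrite /Rintegral integralE.
set f := fun x => (sym_weight x * x ^+ n.*2.+1)%:E.
have mf : measurable_fun setT f by exact/measurable_EFinP.
have fN x : f (- x) = (- f x)%E.
  by rewrite /f sym_weightN exprNn -signr_odd /= odd_double expr1 mulN1r mulrN.
have -> : (\int[mu]_x f^\- x = \int[mu]_x f^\+ x)%E; last first.
  by rewrite subee//; exact: integrable_pos_fin_num (sym_weight_integrable _).
rewrite [LHS]ge0_integral_split0//; last exact: measurable_funeneg.
rewrite [RHS]ge0_integral_split0//; last exact: measurable_funepos.
rewrite addeC; congr (_ + _)%E; apply: eq_integral => t _.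
  by rewrite funeposE funenegE fN.
by rewrite funeposE funenegE fN oppeK.
Qed.

End Weight.

Local Open Scope complex_scope.

Section WeightForm.
Variables (R : realType) (p b y : R).
Hypotheses (p0 : 0 < p) (p1 : p < 1) (b0 : 0 < b) (y0 : 0 < y).
Local Notation mu := (@lebesgue_measure R).
Local Notation I := (qgamma_integral_value p 0).
Local Notation w := (sym_weight p b y).

Lemma qgamma_shift z : 0 < z -> I (z + 1) = (p `^ (- z) - 1) * I z.
Proof.
move=> z0; have := mellin_qexp_shift p0 p1 (mellin_qexp p0 p1 z0).
by rewrite mellin_qexp ?addr_gt0// => -[].
Qed.

Lemma sym_weight_lincomb (a : nat -> R) m :
  mu.-integrable setT (EFin \o (fun x => w x * \sum_(i < m) a i * x ^+ i)) /\
  Rintegral mu setT (fun x => w x * \sum_(i < m) a i * x ^+ i) =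
  \sum_(i < m) a i * Rintegral mu setT (fun x => w x * x ^+ i).
Proof.
elim: m => [|m [IH1 IH2]].
  have -> : (fun x => w x * \sum_(i < 0) a i * x ^+ i) = cst 0.
    by apply/funext => x; rewrite big_ord0 mulr0.
  by rewrite big_ord0; split; [exact: integrable0|rewrite /Rintegral integral0].
have E : (fun x => w x * \sum_(i < m.+1) a i * x ^+ i) =
    (fun x => w x * (\sum_(i < m) a i * x ^+ i) + a m * (w x * x ^+ m)).
  by apply/funext => x; rewrite big_ord_recr/=; ring.
have im := sym_weight_integrable p0 p1 b0 y0 m.
have iam : mu.-integrable setT (EFin \o (fun x => a m * (w x * x ^+ m))).
  by have := integrableZl measurableT (a m) im.
rewrite E big_ord_recr/= -IH2; split.
  by have := integrableD measurableT IH1 iam.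
by rewrite RintegralD// RintegralZl.
Qed.

Lemma Re_horner (f : {poly R[i]}) (x : R) :
  complex.Re f.[x%:C] = \sum_(i < size f) complex.Re f`_i * x ^+ i.
Proof.
rewrite horner_coef raddf_sum; apply: eq_bigr => i _.
by rewrite -rmorphXn; case: (f`_i) => c d /=; rewrite mulr0 subr0.
Qed.

Lemma Im_horner (f : {poly R[i]}) (x : R) :
  complex.Im f.[x%:C] = \sum_(i < size f) complex.Im f`_i * x ^+ i.
Proof.
rewrite horner_coef raddf_sum; apply: eq_bigr => i _.
by rewrite -rmorphXn; case: (f`_i) => c d /=; rewrite mulr0 add0r.
Qed.

Lemma sym_weight_weighted (f : {poly R[i]}) : weighted_integrable w f /\
  weighted_integral w f =
  \sum_(i < size f) f`_i * (Rintegral mu setT (fun x => w x * x ^+ i))%:C.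
Proof.
have [r1 r2] := sym_weight_lincomb (fun i => complex.Re f`_i) (size f).
have [i1 i2] := sym_weight_lincomb (fun i => complex.Im f`_i) (size f).
have rE : (fun x => w x * complex.Re f.[x%:C]) =
    (fun x => w x * \sum_(i < size f) complex.Re f`_i * x ^+ i).
  by apply/funext => x; rewrite Re_horner.
have iE : (fun x => w x * complex.Im f.[x%:C]) =
    (fun x => w x * \sum_(i < size f) complex.Im f`_i * x ^+ i).
  by apply/funext => x; rewrite Im_horner.
rewrite /weighted_integrable /weighted_integral rE iE; split => //.
rewrite r2 i2; apply/eqP; rewrite eq_complex/= !raddf_sum.
by apply/andP; split; apply/eqP; apply: eq_bigr => i _;
  case: (f`_i) => c d /=; rewrite mulr0 ?subr0 ?add0r.
Qed.

End WeightForm.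

(** * Complex powers *)

Section ComplexPower.
Variable R : realType.
Implicit Types (z w : R[i]) (a c x : R).

Lemma cexpD z w : cexp (z + w) = cexp z * cexp w.
Proof.
case: z w => [a b] [c d]; rewrite /cexp /= expRD cosD sinD; simpc.
by congr (_ +i* _); ring.
Qed.

Lemma cexp0 : cexp 0 = 1 :> R[i].
Proof. by rewrite /cexp /= expR0 cos0 sin0; simpc. Qed.

Lemma cexp_neq0 z : cexp z != 0.
Proof.
apply/eqP => z0; have := cexpD z (- z).
by rewrite subrr cexp0 z0 mul0r => /eqP; rewrite oner_eq0.
Qed.

Lemma cmodE z : `|z| = (cmod z)%:C.
Proof. by case: z => a b; rewrite /cmod normc_def. Qed.

Lemma cmod_gt0 z : z != 0 -> 0 < cmod z.
Proof. by move=> z0; have := z0; rewrite -normr_gt0 cmodE ltcR. Qed.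

Lemma cmod_sqr z : cmod z ^+ 2 = complex.Re z ^+ 2 + complex.Im z ^+ 2.
Proof.
by case: z => a b; rewrite /cmod normc_def /= sqr_sqrtr// addr_ge0 ?sqr_ge0.
Qed.

Lemma cexp_clog z : z != 0 -> cexp (clog z) = z.
Proof.
move=> z0; have m0 := cmod_gt0 z0; have := cmod_sqr z.
rewrite /cexp /clog /= lnK// /carg; case: z z0 m0 => [x y] z0 /=.
set m := cmod _ => m0 mE; have mn0 : m != 0 by rewrite gt_eqF.
have xm : -1 <= x / m <= 1.
  rewrite -ler_norml normrM normfV (gtr0_norm m0) ler_pdivrMr// mul1r.
  rewrite -(ler_pXn2r (n := 2))// ?nnegrE ?normr_ge0 ?(ltW m0)//.
  by rewrite real_normK ?num_real// mE lerDl sqr_ge0.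
have cE : cos (acos (x / m)) = x / m by rewrite acosK// in_itv/=.
have sE : sin (acos (x / m)) = `|y| / m.
  rewrite sin_acos//.
  have -> : 1 - (x / m) ^+ 2 = (`|y| / m) ^+ 2.
    rewrite !expr_div_n real_normK ?num_real// mE.
    by field; rewrite -mE expf_neq0.
  by rewrite sqrtr_sqr ger0_norm// divr_ge0 ?normr_ge0// ltW.
have mK r : m * (r / m) = r by rewrite mulrC divfK.
case: leP => y0; rewrite ?cosN ?sinN cE sE; simpc; rewrite ?mulrN !mK.
  by rewrite ger0_norm.
by rewrite ltr0_norm// opprK.
Qed.

Lemma cpowD z a c : cpow z (a + c) = cpow z a * cpow z c.
Proof. by rewrite /cpow rmorphD mulrDl cexpD. Qed.

Lemma cpow0 z : cpow z 0 = 1.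
Proof. by rewrite /cpow mul0r cexp0. Qed.

Lemma cpow_neq0 z a : cpow z a != 0.
Proof. exact: cexp_neq0. Qed.

Lemma cpow1 z : z != 0 -> cpow z 1 = z.
Proof. by move=> z0; rewrite /cpow mul1r cexp_clog. Qed.

Lemma cpowN z a : cpow z (- a) = (cpow z a)^-1.
Proof.
apply: (mulIf (cpow_neq0 z a)); rewrite mulVf ?cpow_neq0//.
by rewrite -cpowD addNr cpow0.
Qed.

Lemma cpow_nat z n : z != 0 -> cpow z n%:R = z ^+ n.
Proof.
move=> z0; elim: n => [|n IH]; first by rewrite cpow0 expr0.
by rewrite -natr1 cpowD cpow1// IH exprSr.
Qed.

Lemma csqrt_sqr z : z != 0 -> csqrt z ^+ 2 = z.
Proof.
move=> z0; rewrite /csqrt expr2 -cpowD -[RHS]cpow1//; congr cpow.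
by field.
Qed.

Lemma cpow_real x a : 0 < x -> cpow x%:C a = (x `^ a)%:C.
Proof.
move=> x0; have mE : cmod x%:C = x.
  by rewrite /cmod normc_def /= expr0n/= addr0 sqrtr_sqr gtr0_norm.
rewrite /cpow /cexp /clog /carg /= lexx mE divff ?gt_eqF// acos1; simpc.
by rewrite cos0 sin0 /powR (gt_eqF x0); simpc.
Qed.

End ComplexPower.

(** * Regularity of symmetrical forms *)

Section Regularity.
Variable R : realType.
Local Notation C := R[i].
Implicit Types (u v : {scalar {poly C}}) (f g : {poly C}).

Lemma form_coefE u f g : u (f * g) = \sum_(i < size f) f`_i * u ('X^i * g).
Proof.
rewrite -{1}[f]coefK poly_def mulr_suml linear_sum.
by apply: eq_bigr => i _; rewrite -scalerAl linearZ.
Qed.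

(** Expanding one of the two factors in powers of x shows that orthogonality to
    all lower powers is enough. *)
Lemma regular_of_triangular u (B : nat -> {poly C}) :
  (forall n, B n \is monic) -> (forall n, size (B n) = n.+1) ->
  (forall n k, (k < n)%N -> u ('X^k * B n) = 0) ->
  (forall n, u ('X^n * B n) != 0) -> regular_form u.
Proof.
move=> mB sB B0 Bn; exists B, (fun n => u ('X^n * B n)).
split => // [n|m n]; first by apply/eqP.
have lt i j : (i < j)%N -> u (B i * B j) = 0.
  move=> ij; rewrite form_coefE big1// => k _; rewrite B0 ?mulr0//.
  by have := ltn_ord k; rewrite [X in (_ < X)%N]sB ltnS => /leq_ltn_trans; apply.
have [nm|mn|->] := ltngtP n m.
- by rewrite mulr0 mulrC lt.
- by rewrite mulr0 lt.
- rewrite mulr1 form_coefE sB big_ord_recr/= big1 ?add0r.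
    have := mB m; rewrite monicE lead_coefE sB => /eqP ->.
    by rewrite mul1r.
  by move=> k _; rewrite B0 ?mulr0.
Qed.

End Regularity.

Section SymmetricPolynomials.
Variables (R : realType) (u v : {scalar {poly R[i]}}) (q a b : R[i]).
Local Notation C := R[i].
Implicit Types f : {poly C}.
Hypothesis hsym : symmetrical u.
Hypothesis hsigma : forall f, sigma_form u f = v f.
Hypothesis hv : forall n, v 'X^(n.+1) = - b * (1 - a * q ^+ n) * v 'X^n.

Lemma form_odd f : u ('X * (f \Po 'X^2)) = 0.
Proof.
rewrite comp_polyE mulr_sumr linear_sum big1// => i _.
rewrite -scalerAr linearZ/= -exprM -exprS mul2n.
by have := hsym i; rewrite /moment => ->; rewrite mulr0.
Qed.

Lemma form_even f : u (f \Po 'X^2) = v f.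
Proof. exact: hsigma. Qed.

(** The numbers - b q ^ n (1 - a q ^ n) and - b a q ^ n (1 - q ^ (n + 1)) are the
    recurrence coefficients of odd and even index of the orthogonal polynomials
    of u, which are P_n(x ^ 2) and x Q_n(x ^ 2). *)
Fixpoint even_odd_parts n : {poly C} * {poly C} :=
  if n is m.+1 then
    let: (P, Q) := even_odd_parts m in
    let P' := 'X * Q - (- b * q ^+ m * (1 - a * q ^+ m)) *: P in
    (P', P' - (- b * a * q ^+ m * (1 - q ^+ m.+1)) *: Q)
  else (1, 1).

Let P n := (even_odd_parts n).1.
Let Q n := (even_odd_parts n).2.

Let PS n : P n.+1 = 'X * Q n - (- b * q ^+ n * (1 - a * q ^+ n)) *: P n.
Proof. by rewrite /P /Q /=; case: (even_odd_parts n). Qed.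

Let QS n : Q n.+1 = P n.+1 - (- b * a * q ^+ n * (1 - q ^+ n.+1)) *: Q n.
Proof. by rewrite /P /Q /=; case: (even_odd_parts n). Qed.

Let nodes n j : C := \prod_(i < n) (q ^+ i - q ^+ j).

Let nodesS n j : nodes n.+1 j = nodes n j * (q ^+ n - q ^+ j).
Proof. by rewrite /nodes big_ord_recr. Qed.

Let nodesSl n j : nodes n.+1 j.+1 = (1 - q ^+ j.+1) * (q ^+ n * nodes n j).
Proof.
rewrite /nodes big_ord_recl expr0; congr (_ * _).
have -> : q ^+ n = \prod_(i < n) q by rewrite prodr_const card_ord.
by rewrite -big_split/=; apply: eq_bigr => i _; rewrite /bump leq0n add1n !exprS mulrBr.
Qed.

(* The products of q ^ i - q ^ j over i < n vanish for j < n: orthogonality can be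
   read off these closed forms.  They come from Heine's continued fraction for
   the series with coefficients (a; q)_n. *)
Let moments_PQ n :
  (forall j, v ('X^j * P n) = (- b * a) ^+ n * q ^+ 'C(n, 2) * nodes n j * v 'X^j) /\
  (forall j, v ('X^(j.+1) * Q n) =
     (- b * a) ^+ n * q ^+ 'C(n.+1, 2) * nodes n j * v 'X^(j.+1)).
Proof.
have bin2S m : 'C(m.+1, 2) = ('C(m, 2) + m)%N by rewrite binS bin1.
elim: n => [|n [IHP IHQ]].
  by split => j; rewrite /P /Q /= mulr1 /nodes big_ord0 !expr0 ?bin0n ?binn/= !mulr1 mul1r.
have hP j : v ('X^j * P n.+1) =
    (- b * a) ^+ n.+1 * q ^+ 'C(n.+1, 2) * nodes n.+1 j * v 'X^j.
  rewrite PS mulrBr mulrA -exprSr linearB -scalerAr linearZ/= IHP IHQ hv nodesS.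
  by rewrite bin2S exprD exprS; ring.
split => // j; rewrite QS mulrBr linearB -scalerAr linearZ/= hP IHQ nodesSl nodesS.
by rewrite !bin2S !exprD !exprS; ring.
Qed.

Let sizes_PQ n : [/\ P n \is monic, size (P n) = n.+1, Q n \is monic & size (Q n) = n.+1].
Proof.
have mono (f g : {poly C}) c m : f \is monic -> size f = m.+1 -> (size g <= m)%N ->
    (f - c *: g \is monic) /\ size (f - c *: g) = m.+1.
  move=> mf sf sg.
  have lt : (size (- (c *: g)) < size f)%N.
    by rewrite size_polyN sf ltnS (leq_trans (size_scale_leq _ _)).
  by rewrite monicE lead_coefDl// size_polyDl// -monicE.
elim: n => [|n [mP sP mQ sQ]].
  by rewrite /P /Q /= monic1 size_poly1.
have [m1 s1] : P n.+1 \is monic /\ size (P n.+1) = n.+2.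
  rewrite PS; apply: mono; rewrite ?sP// ?monicMl ?monicX//.
  by rewrite mulrC size_mulX ?monic_neq0// sQ.
have [m2 s2] : Q n.+1 \is monic /\ size (Q n.+1) = n.+2.
  by rewrite QS; apply: mono; rewrite ?sQ.
by split.
Qed.

Let B n := if odd n then 'X * (Q n./2 \Po 'X^2) else P n./2 \Po 'X^2.

Let comp_X2 f m : f \is monic -> size f = m.+1 ->
  (f \Po 'X^2 \is monic) /\ size (f \Po 'X^2) = m.*2.+1.
Proof.
move=> mf sf; have f0 := monic_neq0 mf; split.
  rewrite monicE lead_coef_comp ?size_polyXn// lead_coefXn expr1n mulr1.
  by rewrite -monicE.
have := size_comp_poly f 'X^2; rewrite sf size_polyXn /= muln2 => <-.
rewrite prednK // size_poly_gt0 comp_poly_eq0 ?size_polyXn //.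
Qed.

Lemma regular_symmetric : a != 0 -> b != 0 -> q != 0 ->
  (forall n : nat, (0 < n)%N -> q ^+ n != 1) ->
  (forall n : nat, v 'X^n != 0) -> regular_form u.
Proof.
move=> a0 b0 q0 q1 v0.
have nodes_neq0 n : nodes n n != 0.
  apply/prodf_neq0 => i _; have := ltn_ord i; move: (nat_of_ord i) => k kn.
  rewrite subr_eq0 -(subnKC (ltnW kn)) exprD -{1}[q ^+ k]mulr1.
  by rewrite (inj_eq (mulfI _)) ?expf_neq0// eq_sym q1// subn_gt0.
have nodes_eq0 n j : (j < n)%N -> nodes n j = 0.
  by move=> jn; rewrite /nodes (bigD1 (Ordinal jn))//= subrr mul0r.
have coef_neq0 n : (- b * a) ^+ n != 0 by rewrite expf_neq0// mulf_neq0// oppr_eq0.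
have X2 k f : 'X^(k.*2) * (f \Po 'X^2) = ('X^k * f) \Po 'X^2.
  by rewrite comp_polyM comp_Xn_poly -exprM mul2n.
have X3 k f : 'X^(k.*2.+1) * ('X * (f \Po 'X^2)) = ('X^(k.+1) * f) \Po 'X^2.
  by rewrite mulrA -exprSr -X2 doubleS.
have Beven m : B m.*2 = P m \Po 'X^2 by rewrite /B odd_double doubleK.
have Bodd m : B m.*2.+1 = 'X * (Q m \Po 'X^2).
  by rewrite /B /= odd_double uphalf_double.
have parity n : exists m, n = m.*2 \/ n = m.*2.+1.
  by exists n./2; have := odd_double_half n; case: (odd n); [right|left].
apply: (@regular_of_triangular _ _ B) => [n|n|n k|n];
    have [m [->|->]] := parity n; have [hP hQ] := moments_PQ m;
    have [h1 h2 h3 h4] := sizes_PQ m; rewrite ?Beven ?Bodd.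
- exact: (comp_X2 h1 h2).1.
- by rewrite monicMl ?monicX//; exact: (comp_X2 h3 h4).1.
- exact: (comp_X2 h1 h2).2.
- have [m2 s2] := comp_X2 h3 h4.
  by rewrite mulrC size_mulX ?monic_neq0// s2.
- have [j [->|->]] := parity k.
    by rewrite ltn_double => jm; rewrite X2 form_even hP nodes_eq0 ?mulr0 ?mul0r.
  by rewrite exprS -mulrA X2 form_odd.
- have [j [->|->]] := parity k.
    by rewrite mulrCA X2 form_odd.
  by rewrite ltnS ltn_double => jm; rewrite X3 form_even hQ nodes_eq0 ?mulr0 ?mul0r.
- by rewrite X2 form_even hP !mulf_neq0// expf_neq0.
- by rewrite X3 form_even hQ !mulf_neq0// expf_neq0.
Qed.

End SymmetricPolynomials.

(** * Pearson equations and class *)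

Section QDifference.
Variable R : realType.
Local Notation C := R[i].
Implicit Types (u : {scalar {poly C}}) (f g Psi : {poly C}) (r c d : C).

(** The right-hand side is linear in f and free of Euclidean quotients. *)
Lemma mulX_Hop r f : r != 1 ->
  'X * Hop r f = (r - 1)^-1 *: (f \Po (r *: 'X) - f).
Proof.
move=> r1; rewrite /Hop divpZr ?subr_eq0// -scalerAr mulrC divpK//.
rewrite -['X]subr0 -polyC0 dvdp_XsubCl rootE hornerD hornerN horner_comp.
by rewrite !hornerE oppr0 mulr0 subrr.
Qed.

Lemma form_coef u f : u f = \sum_(i < size f) f`_i * u 'X^i.
Proof. by have := form_coefE u f 1; under eq_bigr do rewrite mulr1; rewrite mulr1. Qed.

(** On x ^ n, the operator x H_r acts as multiplication by (r ^ n - 1) / (r - 1). *)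
Lemma Pearson_eqX_moments r u k d m : r != 1 ->
  Pearson_eq r u 'X (k *: ('X^m + d%:P)) <->
  forall n, (r ^+ n - 1) / (r - 1) * moment u n
    = k * (moment u (n + m) + d * moment u n).
Proof.
move=> r1; rewrite /Pearson_eq /Hform /mulform /moment.
have E f : - u ('X * Hop r f) + u (k *: ('X^m + d%:P) * f) =
    - (r - 1)^-1 * (u (f \Po (r *: 'X)) - u f) + k * (u (f * 'X^m) + d * u f).
  have -> : u ('X * Hop r f) = (r - 1)^-1 * (u (f \Po (r *: 'X)) - u f).
    by rewrite mulX_Hop// linearZ/= raddfB.
  have -> : u (k *: ('X^m + d%:P) * f) = k * (u (f * 'X^m) + d * u f).
    by rewrite -scalerAl linearZ/= mulrDl raddfD/= mul_polyC linearZ/= ['X^m * f]mulrC.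
  by rewrite mulNr.
split=> [h n|h f].
  have := h 'X^n; rewrite E comp_Xn_poly exprZn linearZ/= -exprD => hn.
  apply/esym/eqP; rewrite -subr_eq0; apply/eqP; rewrite -[RHS]hn.
  by move: (r - 1)^-1 (u _) (u _) => s x y; ring.
rewrite E [u f]form_coef form_coefE comp_polyE linear_sum/=.
rewrite -sumrB !mulr_sumr -big_split/= mulr_sumr -big_split/=.
rewrite big1// => i _; rewrite -exprD exprZn !linearZ/=.
move: (h i) => /eqP; rewrite -subr_eq0 => /eqP hi.
transitivity (- f`_i * ((r ^+ i - 1) / (r - 1) * u 'X^i
   - k * (u 'X^(i + m) + d * u 'X^i))); last by rewrite hi mulr0.
by rewrite /GRing.scale/=; move: (r - 1)^-1 (u _) (u _) => s x y; ring.
Qed.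

Lemma Hop_X r : r != 1 -> Hop r 'X = 1.
Proof.
move=> r1; apply: (mulfI (x := 'X)); first by rewrite polyX_eq0.
rewrite mulX_Hop// comp_polyX -{2}['X]scale1r -scalerBl scalerA mulVf ?scale1r ?mulr1//.
by rewrite subr_eq0.
Qed.

(** Characterizes the quotient at 0 without Euclidean division. *)
Lemma mulX_theta0 f : 'X * theta 0 f = f - f.[0]%:P.
Proof.
rewrite /theta subr0 mulrC divpK//.
by rewrite -['X]subr0 -polyC0 dvdp_XsubCl rootE hornerD hornerN hornerC subrr.
Qed.

Lemma zeros_X : zeros ('X : {poly C}) = [:: 0].
Proof.
rewrite /zeros; case: closed_field_poly_normal => s /= sE.
rewrite lead_coefX scale1r in sE.
have rootX z : (z \in s) = (z == 0).
  by rewrite -root_prod_XsubC -sE rootE hornerX.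
apply: perm_small_eq => //; apply: uniq_perm => //; first exact: undup_uniq.
by move=> z; rewrite mem_undup rootX inE.
Qed.

(** At the only zero 0 of Phi, the first modulus of the criterion is that of
    r k d + 1. *)
Lemma semiclassical_class1 r u k d : r != 1 -> k != 0 -> moment u 1 = 0 ->
  r * (k * d) + 1 != 0 ->
  semiclassical_pair r u 'X (k *: ('X^2 + d%:P)) -> semiclassical_of_class r u 1.
Proof.
move=> r1 k0 u1 h pr; exists 'X, (k *: ('X^2 + d%:P)); split => //.
  rewrite size_scale// size_polyDl ?size_polyXn ?size_polyX//.
  by rewrite (leq_ltn_trans (size_polyC_leq1 _)).
rewrite /class_criterion zeros_X big_seq1 mulr0 mul0r Hop_X//.
have -> : theta 0 'X = 1 :> {poly C}.
  apply: (mulfI (x := 'X)); first by rewrite polyX_eq0.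
  by rewrite mulX_theta0 hornerX polyC0 subr0 mulr1.
have -> : theta 0 1 = 0 :> {poly C}.
  apply: (mulfI (x := 'X)); first by rewrite polyX_eq0.
  by rewrite mulX_theta0 hornerC subrr mulr0.
have -> : theta 0 (k *: ('X^2 + d%:P)) = k *: 'X.
  apply: (mulfI (x := 'X)); first by rewrite polyX_eq0.
  rewrite mulX_theta0 hornerZ hornerD hornerXn hornerC expr0n/= add0r.
  rewrite scalerDr -[k *: d%:P]mul_polyC -polyCM addrK.
  by rewrite -scalerAr -expr2.
rewrite hornerZ hornerD hornerXn expr0n/= add0r !hornerC.
by rewrite ltr_pwDl// normr_gt0.
Qed.

End QDifference.

(** * Series of Dirac forms *)

Section ComplexSeries.
Variable R : realType.
Local Notation C := R[i].

Lemma seq_cvg_toP (K : numFieldType) (z : nat -> K) l : seq_cvg_to z l <->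
  forall e : K, 0 < e -> exists N, forall n, (N <= n)%N -> `|l - z n| < e.
Proof.
split => [/cvgrPdist_lt h e e0|h].
  by have [N _ hN] := h e e0; exists N.
apply/cvgrPdist_lt => e e0; have [N hN] := h e e0.
by exists N.
Qed.

Lemma seq_cvg_to_real (x : nat -> R) (l : R) : x @ \oo --> l ->
  seq_cvg_to (fun n => (x n)%:C) l%:C.
Proof.
move=> /(seq_cvg_toP (K := R)) h; apply/seq_cvg_toP => -[e e'].
rewrite ltcE/= => /andP[/eqP -> e0]; have [N hN] := h e e0.
exists N => n /hN; rewrite -rmorphB normc_def/= expr0n/= addr0 sqrtr_sqr.
by rewrite ltcE/= eqxx.
Qed.

Lemma seq_cvg_toD (K : numFieldType) (y z : nat -> K) l m :
  seq_cvg_to y l -> seq_cvg_to z m -> seq_cvg_to (fun n => y n + z n) (l + m).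
Proof. exact: cvgD. Qed.

Lemma seq_cvg_toZ (K : numFieldType) (z : nat -> K) l c :
  seq_cvg_to z l -> seq_cvg_to (fun n => c * z n) (c * l).
Proof. by move=> h; apply: cvgM => //; exact: cvg_cst. Qed.

Lemma seq_cvg_to_sum (K : numFieldType) (z : nat -> nat -> K) l m :
  (forall i, seq_cvg_to (z i) (l i)) ->
  seq_cvg_to (fun n => \sum_(i < m) z i n) (\sum_(i < m) l i).
Proof.
move=> h; elim: m => [|m IH].
  under eq_fun do rewrite big_ord0; rewrite big_ord0; exact: cvg_cst.
under eq_fun do rewrite big_ord_recr; rewrite big_ord_recr/=.
exact: seq_cvg_toD.
Qed.

(** The odd moments of each pair of Dirac forms vanish, and the value of a form at
    a polynomial involves finitely many moments. *)
Lemma form_series_dirac_pairs (u : {scalar {poly C}}) (w c : nat -> C) (L : C) :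
  symmetrical u ->
  (forall n, seq_cvg_to (fun N => \sum_(0 <= k < N) w k * (c k ^+ 2) ^+ n)
     (L * moment u n.*2)) ->
  form_series (fun k => scale_form (w k)
      (scale_form 2^-1 (add_form (dirac_form (c k)) (dirac_form (- c k)))))
    (fun f => L * u f).
Proof.
move=> usym h f.
have term k g : scale_form (w k)
      (scale_form 2^-1 (add_form (dirac_form (c k)) (dirac_form (- c k)))) g
    = w k * (2^-1 * (g.[c k] + g.[- c k])) by [].
have mono i : seq_cvg_to (fun N => \sum_(0 <= k < N) w k *
    (2^-1 * (c k ^+ i + (- c k) ^+ i))) (L * u 'X^i).
  have := odd_double_half i; case: (odd i) => /= <-.
    have u0 : u 'X^(i./2.*2.+1) = 0 := usym _.
    rewrite add1n u0 mulr0.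
    under eq_fun => N.
      rewrite big1; first by over.
      move=> k _; rewrite exprNn -signr_odd /= odd_double expr1 mulN1r subrr.
      by rewrite !mulr0.
    exact: cvg_cst.
  rewrite add0n; have := h i./2; rewrite /moment; congr seq_cvg_to.
  apply/funext => N; apply: eq_bigr => k _.
  rewrite exprNn -signr_odd odd_double expr0 mul1r -mul2n exprM.
  by congr (_ * _); field.
rewrite form_coef mulr_sumr.
have -> : (fun n => \sum_(0 <= k < n) scale_form (w k) (scale_form 2^-1
      (add_form (dirac_form (c k)) (dirac_form (- c k)))) f) =
  (fun n => \sum_(i < size f) f`_i * \sum_(0 <= k < n) w k *
    (2^-1 * (c k ^+ i + (- c k) ^+ i))).
  apply/funext => n; under [RHS]eq_bigr do rewrite mulr_sumr.
  rewrite exchange_big; apply: eq_bigr => k _.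
  rewrite term !horner_coef -big_split/= !mulr_sumr.
  by apply: eq_bigr => i _; ring.
apply: (@seq_cvg_to_sum _ (fun i n => f`_i * \sum_(0 <= k < n) w k *
    (2^-1 * (c k ^+ i + (- c k) ^+ i))) (fun i => L * (f`_i * u 'X^i))) => i.
by rewrite mulrCA; exact: seq_cvg_toZ.
Qed.

Lemma qpoch_realC (x p : R) n : qpoch x%:C p%:C n = (qpoch x p n)%:C.
Proof.
rewrite /qpoch rmorph_prod; apply: eq_bigr => k _.
by rewrite rmorphB rmorph1 rmorphM rmorphXn.
Qed.

End ComplexSeries.

(** * The form u *)

Lemma bin2_real (R : numFieldType) k :
  'C(k, 2)%:R = 2^-1 * k%:R * (k%:R - 1) :> R.
Proof.
elim: k => [|k IH]; first by rewrite bin0n mulr0 mul0r.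
by rewrite binS bin1 natrD IH -natr1; field.
Qed.

Lemma powR_half_sqr (R : realType) (x : R) k : 0 < x ->
  (x `^ (k%:R / 2)) ^+ 2 = x ^+ k.
Proof.
move=> x0; rewrite -powR_mulrn ?powR_ge0// -powRrM -powR_mulrn ?(ltW x0)//.
by congr (_ `^ _); field.
Qed.

Section Laguerre.
Variables (R : realType) (alpha : R) (q b : R[i]) (v u : {scalar {poly R[i]}}).
Hypotheses (hq : Ctilde q) (hb0 : b <> 0)
  (hb : forall n : nat, b <> cpow q (n%:R + 1 + alpha))
  (hv : is_qinv_Laguerre alpha b q v)
  (hsym : symmetrical u)
  (hsigma : forall f, sigma_form u f = v f).
Local Notation Q := (cpow q (alpha + 1)).
Local Notation a := (b^-1 * Q).
Local Notation r := (csqrt q).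

Let q_neq0 : q != 0. Proof. by have [/eqP] := hq. Qed.
Let b_neq0 : b != 0. Proof. exact/eqP. Qed.
Let qX_neq1 n : (0 < n)%N -> q ^+ n != 1.
Proof. by move=> n0; have [_ h] := hq; apply/eqP; exact: h. Qed.
Let q_neq1 : q != 1. Proof. by have := qX_neq1 (ltn0Sn 0); rewrite expr1. Qed.
Let r_neq1 : r != 1.
Proof.
by apply: contra_neq q_neq1 => r1; rewrite -(csqrt_sqr q_neq0) r1 expr1n.
Qed.

Let QN : cpow q (- alpha - 1) = Q^-1.
Proof. by rewrite -opprD cpowN. Qed.

Lemma Laguerre_rec n : v 'X^(n.+1) = - b * (1 - a * q ^+ n) * v 'X^n.
Proof.
have [_ hP] := hv.
have := (@Pearson_eqX_moments R q v ((q - 1)^-1 * cpow q (- alpha - 1)) (b - Q) 1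
  q_neq1).1 hP n.
rewrite /moment addn1 QN => hn.
have q1 : q - 1 != 0 by rewrite subr_eq0.
have Q0 : Q != 0 by exact: cpow_neq0.
have : Q * (q - 1) * ((q ^+ n - 1) / (q - 1) * v 'X^n) =
    v 'X^(n.+1) + (b - Q) * v 'X^n.
  by rewrite hn; field; rewrite q1 Q0.
move=> /eqP; rewrite -subr_eq => /eqP <-.
by field; rewrite q1 b_neq0.
Qed.

Lemma Laguerre_moment n : moment u n.*2 = (- b) ^+ n * qpoch a q n.
Proof.
have h f : u (f \Po 'X^2) = v f := hsigma f.
rewrite /moment -mul2n exprM -(comp_Xn_poly _ n) h.
elim: n => [|n IH]; first by have [v0 _] := hv; rewrite expr0 mul1r qpoch0; exact: v0.
by rewrite Laguerre_rec IH qpochS exprS; ring.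
Qed.

Let moment_neq0 n : v 'X^n != 0.
Proof.
elim: n => [|n IH]; first by have [v0 _] := hv; rewrite [v _]v0 oner_eq0.
rewrite Laguerre_rec !mulf_neq0 ?oppr_eq0// subr_eq0; apply/eqP => h.
apply: (hb (n := n)).
have -> : n%:R + 1 + alpha = (alpha + 1) + n%:R by ring.
by rewrite cpowD cpow_nat// -[LHS]mulr1 [X in b * X]h !mulrA mulfV// mul1r.
Qed.

(** The hypothesis on b says that no moment of v vanishes. *)
Lemma Laguerre_regular : regular_form u.
Proof.
apply: (@regular_symmetric R u v q a b) => //.
- exact: Laguerre_rec.
- by apply: mulf_neq0; [rewrite invr_eq0|exact: cpow_neq0].
Qed.

(** The even moments of u are those of v and (sqrt q) ^ (2 m) = q ^ m, so that
    the recurrence equivalent to the equation of u is that of v. *)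
Lemma Laguerre_semiclassical : semiclassical_pair r u 'X
  (cpow q (- alpha - 1) * (r - 1)^-1 *: ('X^2 + (b - Q)%:P)).
Proof.
have r1 : r - 1 != 0 by rewrite subr_eq0.
have k0 : cpow q (- alpha - 1) * (r - 1)^-1 != 0.
  by apply: mulf_neq0; [exact: cpow_neq0|rewrite invr_eq0].
split; first exact: Laguerre_regular.
- exact: monicX.
- rewrite size_scale//.
  by rewrite size_polyDl ?size_polyXn// (leq_ltn_trans (size_polyC_leq1 _)).
- apply: (@Pearson_eqX_moments R r u _ (b - Q) 2 r_neq1).2 => n.
  have := odd_double_half n; set m := n./2; case: (odd n) => <-.
    rewrite add1n addn2 -doubleS.
    by rewrite (hsym m) (hsym m.+1) !mulr0 addr0 mulr0.
  rewrite add0n addn2 -doubleS !Laguerre_moment qpochS QN exprS.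
  have -> : r ^+ m.*2 = q ^+ m by rewrite -mul2n exprM csqrt_sqr.
  have Q0 : Q != 0 by exact: cpow_neq0.
  by field; rewrite r1 Q0 b_neq0.
Qed.

Lemma Laguerre_class1 : b <> cpow q (alpha + 2^-1) -> semiclassical_of_class r u 1.
Proof.
move=> hb2; have r1 : r - 1 != 0 by rewrite subr_eq0.
have Q0 : Q != 0 by exact: cpow_neq0.
apply: semiclassical_class1 Laguerre_semiclassical => //.
- by apply: mulf_neq0; [exact: cpow_neq0|rewrite invr_eq0].
- exact: (hsym 0).
rewrite QN.
have -> : r * (Q^-1 / (r - 1) * (b - Q)) + 1 = (r * b - Q) / (Q * (r - 1)).
  by field; rewrite r1 Q0.
apply: mulf_neq0; last by rewrite invr_eq0; exact: mulf_neq0.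
rewrite subr_eq0; apply/eqP => h.
have r0 : r != 0 by exact: cpow_neq0.
apply: hb2; apply: (mulfI r0); rewrite h /csqrt -cpowD; congr cpow.
by field.
Qed.

Section RealParameters.
Variables (q0 b0 : R).
Hypotheses (qE : q = q0%:C) (bE : b = b0%:C) (q0_gt0 : 0 < q0).

Let b0_neq0 : b0 != 0.
Proof. by have := b_neq0; rewrite bE; apply: contra_neq => ->. Qed.

Let real_moment n : R := (- b0) ^+ n * qpoch (b0^-1 * q0 `^ (alpha + 1)) q0 n.

Lemma Laguerre_real_moment n : moment u n.*2 = (real_moment n)%:C.
Proof.
rewrite Laguerre_moment bE qE cpow_real// -fmorphV -rmorphM qpoch_realC.
by rewrite -rmorphN -rmorphXn -rmorphM.
Qed.

(** Up to the normalization, both the moments of the weight and those of u are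
    multiplied by q ^ (alpha + 1 + n) - b when n increases by one, because
    p ^ (- y) = q ^ (alpha + 1) / b for p = 1 / q. *)
Lemma Laguerre_weight : 1 < q0 -> 0 < b0 -> b0 < q0 `^ (alpha + 1) ->
        let w (x : R) := `|x| `^ (2 * alpha - 2 * (ln b0 / ln q0) + 1)
                         / qpoch_inf (- b0^-1 * x ^+ 2) q0^-1 in
        let k (x : R) := x `^ (alpha - ln b0 / ln q0)
                         / qpoch_inf (- b0^-1 * x) q0^-1 in
        let Kinv := Rintegral lebesgue_measure `]0, +oo[ k in
        let y := alpha - ln b0 / ln q0 + 1 in
        [/\ lebesgue_measure.-integrable `]0, +oo[ (EFin \o k),
            Kinv = b0 `^ y * qgamma_integral_value q0^-1 0 y
          & forall f : {poly R[i]},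
              weighted_integrable w f /\
              u f = (Kinv^-1)%:C * weighted_integral w f].
Proof.
move=> q1 b0_gt0 bq w k Kinv y; set p := q0^-1 in w k Kinv *.
have p0 : 0 < p by rewrite invr_gt0.
have p1 : p < 1 by rewrite invf_lt1.
have lq : 0 < ln q0 by rewrite ln_gt0.
have y0 : 0 < y.
  have : ln b0 / ln q0 < alpha + 1.
    by rewrite ltr_pdivrMr// -ln_powR ltr_ln ?posrE ?powR_gt0.
  by rewrite /y; lra.
have pyE : p `^ (- y) = q0 `^ (alpha + 1) / b0.
  rewrite /p -powR_inv1 ?(ltW q0_gt0)// -powRrM mulN1r opprK.
  have -> : y = alpha + 1 - ln b0 / ln q0 by rewrite /y; ring.
  rewrite powRD ?(gt_eqF q0_gt0) ?implybT//; congr (_ * _).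
  rewrite powRN; congr (_^-1).
  by rewrite /powR (gt_eqF q0_gt0) divfK ?gt_eqF// lnK ?posrE.
have kE : k = fun t => t `^ (y - 1) * qexp p (b0^-1 * t).
  by apply/funext => t; rewrite /k /qexp mulNr /y addrK.
have wE : w = sym_weight p b0 y.
  apply/funext => x; rewrite /w /sym_weight /qexp mulNr; congr (_ `^ _ / _).
  by rewrite /y; ring.
have cq : nonneg_cont (fun t => qexp p (b0^-1 * t)).
  have := @nonneg_cont_comp R (qexp p) b0^-1 1.
  rewrite invr_gt0 => /(_ b0_gt0 (nonneg_cont_qexp p0 p1)).
  by under eq_fun do rewrite expr1.
have ck := nonneg_cont_mellin y cq.
have KE : Kinv = b0 `^ y * qgamma_integral_value p 0 y.
  by rewrite /Kinv kE /Rintegral -[X in fine X]/(mellin _ _) mellin_qexp_scale.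
have K0 : 0 < Kinv by rewrite KE mulr_gt0 ?powR_gt0// qgamma_integral_gt0.
split => //.
  rewrite kE; apply/integrableP; split; first exact: nonneg_cont_emeasurable ck.
  rewrite [X in (X < _)%E](_ : _ = mellin (fun t => qexp p (b0^-1 * t)) y).
    by rewrite mellin_qexp_scale// ltry.
  apply: eq_integral => t; rewrite inE/= in_itv/= andbT => t0.
  by rewrite ger0_norm//; exact: (ck t t0).2.
have mom n : b0 `^ (y + n%:R) * qgamma_integral_value p 0 (y + n%:R) =
    Kinv * real_moment n.
  elim: n => [|n IH]; first by rewrite addr0 KE /real_moment expr0 mul1r qpoch0 mulr1.
  have yn : 0 < y + n%:R by rewrite ltr_pwDl.
  rewrite -natr1 addrA qgamma_shift//.
  have -> : b0 `^ (y + n%:R + 1) = b0 `^ (y + n%:R) * b0.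
    rewrite powRD ?(gt_eqF b0_gt0) ?implybT//; congr (_ * _).
    by rewrite powRr1// ltW.
  have -> : p `^ (- (y + n%:R)) = q0 `^ (alpha + 1) / b0 * q0 ^+ n.
    rewrite opprD [p `^ (- y - _)]powRD ?(gt_eqF p0) ?implybT// pyE; congr (_ * _).
    by rewrite powRN powR_mulrn ?(ltW p0)// /p exprVn invrK.
  transitivity ((b0 `^ (y + n%:R) * qgamma_integral_value p 0 (y + n%:R)) *
     (b0 * (q0 `^ (alpha + 1) / b0 * q0 ^+ n - 1))); first by ring.
  rewrite IH /real_moment qpochS [(- b0) ^+ n.+1]exprS; field.
  exact: b0_neq0.
move=> f; rewrite wE; have [h1 h2] := sym_weight_weighted p0 p1 b0_gt0 y0 f.
split => //; rewrite h2 form_coef mulr_sumr; apply: eq_bigr => i _.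
rewrite mulrCA; congr (_ * _).
have := odd_double_half i; set m := i./2; case: (odd i) => <-.
  rewrite add1n sym_weight_moment_odd// rmorph0 mulr0.
  exact: (hsym m).
rewrite add0n sym_weight_moment_even// mom.
rewrite -rmorphM mulKf ?gt_eqF//.
exact: Laguerre_real_moment.
Qed.

(** With p = 1 / q and A = q ^ alpha / b, the masses at the points of square
    - b q ^ k sum to Euler's second series at - A q ^ n, whose value
    (A q ^ n; p)_oo is (A; p)_oo times (A q; q)_n. *)
Lemma Laguerre_discrete_gt1 : 1 < q0 -> b0 < 0 ->
        exists S : {poly R[i]} -> R[i],
          form_series
            (fun k : nat =>
               let c := (Num.sqrt (- b0) * q0 `^ (k%:R / 2))%:C in
               scale_form
                 (q0 `^ (- (2^-1 * k%:R * (k%:R - 1))) / qpoch q0^-1 q0^-1 k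
                    * (- b0^-1 * q0 `^ alpha) ^+ k)%:C
                 (scale_form 2^-1 (add_form (dirac_form c) (dirac_form (- c)))))
            S
          /\ forall f : {poly R[i]},
               u f = ((qpoch_inf (b0^-1 * q0 `^ alpha) q0^-1)^-1)%:C * S f.
Proof.
move=> q1 b0_lt0; set p := q0^-1.
have p0 : 0 < p by rewrite invr_gt0.
have p1 : p < 1 by rewrite invf_lt1.
set A := b0^-1 * q0 `^ alpha; have A0 : A <= 0.
  by rewrite mulr_le0_ge0 ?powR_ge0// invr_le0 ltW.
have L0 : qpoch_inf A p != 0 by rewrite gt_eqF// qpoch_inf_gt0// (le_lt_trans A0).
exists (fun f => (qpoch_inf A p)%:C * u f); split; last first.
  by move=> f; rewrite mulrA -rmorphM mulVf// mul1r.
apply: form_series_dirac_pairs => // n.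
rewrite Laguerre_real_moment -rmorphM.
have -> : qpoch_inf A p * real_moment n = (- b0) ^+ n * qpoch_inf (- (- A * q0 ^+ n)) p.
  rewrite mulNr opprK (qpoch_inf_shift p0 p1 (A * q0 ^+ n) n).
  have -> : A * q0 ^+ n * p ^+ n = A by rewrite /p exprVn mulfK// expf_neq0 ?gt_eqF.
  rewrite /real_moment /p qpoch_rev ?gt_eqF//.
  have -> : b0^-1 * q0 `^ (alpha + 1) = A * q0.
    rewrite /A -mulrA powRD ?(gt_eqF q0_gt0) ?implybT//.
    by rewrite powRr1 ?ltW.
  by ring.
have Aq : 0 <= - A * q0 ^+ n.
  by rewrite mulr_ge0 ?oppr_ge0// exprn_ge0// ltW.
have h : (fun N => (- b0) ^+ n * euler2_psum p (- A * q0 ^+ n) N) @ \oo -->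
    (- b0) ^+ n * qpoch_inf (- (- A * q0 ^+ n)) p.
  by apply: cvgM; [exact: cvg_cst|exact: cvg_euler2_psum].
have := seq_cvg_to_real h; congr seq_cvg_to; apply/funext => N.
rewrite /euler2_psum mulr_sumr rmorph_sum; apply: eq_bigr => k _.
rewrite -[in RHS]rmorphXn -[in RHS]rmorphXn -rmorphM; congr (_%:C).
rewrite [(Num.sqrt _ * _) ^+ 2]exprMn sqr_sqrtr ?oppr_ge0 ?(ltW b0_lt0)//.
rewrite powR_half_sqr//.
have -> : q0 `^ (- (2^-1 * k%:R * (k%:R - 1))) = p ^+ 'C(k, 2).
  rewrite powRN /p exprVn -powR_mulrn ?(ltW q0_gt0)//; congr (_ `^ _)^-1.
  by rewrite bin2_real.
have -> : - b0^-1 * q0 `^ alpha = - A by rewrite /A mulNr.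
rewrite [(- A * _) ^+ k]exprMn [(- b0 * _) ^+ n]exprMn -!exprM [(n * k)%N]mulnC.
by move: (- A) => B; ring.
Qed.

(** The points have square - b q ^ k, and the moment of order 2 n is Euler's
    first series at a q ^ n. *)
Lemma Laguerre_discrete_lt1 : q0 < 1 -> q0 `^ (alpha + 1) < b0 ->
        exists S : {poly R[i]} -> R[i],
          form_series
            (fun k : nat =>
               let c := 'i%C * (Num.sqrt b0 * q0 `^ (k%:R / 2))%:C in
               scale_form
                 ((b0^-1 * q0 `^ (alpha + 1)) ^+ k / qpoch q0 q0 k)%:C
                 (scale_form 2^-1 (add_form (dirac_form c) (dirac_form (- c)))))
            S
          /\ forall f : {poly R[i]},
               u f = (qpoch_inf (b0^-1 * q0 `^ (alpha + 1)) q0)%:C * S f.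
Proof.
move=> q1 bq; set A := b0^-1 * q0 `^ (alpha + 1).
have b0_gt0 : 0 < b0 by rewrite (lt_trans _ bq)// powR_gt0.
have A0 : 0 <= A by rewrite mulr_ge0 ?powR_ge0// invr_ge0 ltW.
have A1 : A < 1 by rewrite /A mulrC ltr_pdivrMr// mul1r.
have L0 : qpoch_inf A q0 != 0 by rewrite gt_eqF// qpoch_inf_gt0.
exists (fun f => (qpoch_inf A q0)^-1%:C * u f); split; last first.
  by move=> f; rewrite mulrA -rmorphM mulfV// mul1r.
apply: form_series_dirac_pairs => // n.
rewrite Laguerre_real_moment -rmorphM.
have Aq : 0 <= A * q0 ^+ n < 1.
  rewrite mulr_ge0 ?exprn_ge0 ?(ltW q0_gt0)//= (le_lt_trans _ A1)//.
  by rewrite ler_piMr// exprn_ile1 ?ltW.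
have -> : (qpoch_inf A q0)^-1 * real_moment n =
    (- b0) ^+ n * (qpoch_inf (A * q0 ^+ n) q0)^-1.
  rewrite (qpoch_inf_shift q0_gt0 q1 A n) /real_moment -/A invfM.
  have qn : qpoch A q0 n != 0 by rewrite gt_eqF// qpoch_gt0.
  by move: (qpoch_inf _ _)^-1 => L; field.
have h : (fun N => (- b0) ^+ n * euler_psum q0 (A * q0 ^+ n) N) @ \oo -->
    (- b0) ^+ n * (qpoch_inf (A * q0 ^+ n) q0)^-1.
  by apply: cvgM; [exact: cvg_cst|exact: cvg_euler_psum].
have := seq_cvg_to_real h; congr seq_cvg_to; apply/funext => N.
rewrite /euler_psum mulr_sumr rmorph_sum; apply: eq_bigr => k _.
have -> : ('i%C * (Num.sqrt b0 * q0 `^ (k%:R / 2))%:C) ^+ 2 = (- b0 * q0 ^+ k)%:C.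
  rewrite exprMn sqr_i -rmorphXn mulN1r -rmorphN mulNr; congr (_%:C).
  by congr (- _); rewrite exprMn sqr_sqrtr ?(ltW b0_gt0)// powR_half_sqr.
rewrite -[in RHS]rmorphXn -rmorphM; congr (_%:C).
rewrite !exprMn -!exprM [(n * k)%N]mulnC; ring.
Qed.

End RealParameters.
End Laguerre.

Theorem proposition5 (R : realType) (alpha : R) (q b : R[i])
    (v u : {scalar {poly R[i]}})
    (hq : Ctilde q)
    (hb0 : b <> 0)
    (hb : forall n : nat, b <> cpow q (n%:R + 1 + alpha))
    (hv : is_qinv_Laguerre alpha b q v)
    (hsym : symmetrical u)
    (hsigma : forall f, sigma_form u f = v f) :
  [/\ (* semiclassical equation and class; when b = q^(alpha + 1/2) the equation
         simplifies by x and u has class zero *)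
      semiclassical_pair (csqrt q) u 'X
        (cpow q (- alpha - 1) * (csqrt q - 1)^-1
           *: ('X^2 + (b - cpow q (alpha + 1))%:P))
      /\ (b <> cpow q (alpha + 2^-1) -> semiclassical_of_class (csqrt q) u 1),
      (* (i) *)
      forall n : nat,
        moment u n.*2 = (- b) ^+ n * qpoch (b^-1 * cpow q (alpha + 1)) q n
        /\ moment u n.*2.+1 = 0,
      (* (ii) *)
      forall q0 b0 : R, q = q0%:C -> b = b0%:C ->
        1 < q0 -> 0 < b0 -> b0 < q0 `^ (alpha + 1) ->
        let w (x : R) := `|x| `^ (2 * alpha - 2 * (ln b0 / ln q0) + 1)
                         / qpoch_inf (- b0^-1 * x ^+ 2) q0^-1 in
        let k (x : R) := x `^ (alpha - ln b0 / ln q0)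
                         / qpoch_inf (- b0^-1 * x) q0^-1 in
        let Kinv := Rintegral lebesgue_measure `]0, +oo[ k in
        let y := alpha - ln b0 / ln q0 + 1 in
        [/\ lebesgue_measure.-integrable `]0, +oo[ (EFin \o k),
            Kinv = b0 `^ y * qgamma_integral_value q0^-1 0 y
          & forall f : {poly R[i]},
              weighted_integrable w f /\
              u f = (Kinv^-1)%:C * weighted_integral w f],
      (* (iii) *)
      forall q0 b0 : R, q = q0%:C -> b = b0%:C ->
        1 < q0 -> b0 < 0 ->
        exists S : {poly R[i]} -> R[i],
          form_series
            (fun k : nat =>
               let c := (Num.sqrt (- b0) * q0 `^ (k%:R / 2))%:C in
               scale_form
                 (q0 `^ (- (2^-1 * k%:R * (k%:R - 1))) / qpoch q0^-1 q0^-1 k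
                    * (- b0^-1 * q0 `^ alpha) ^+ k)%:C
                 (scale_form 2^-1 (add_form (dirac_form c) (dirac_form (- c)))))
            S
          /\ forall f : {poly R[i]},
               u f = ((qpoch_inf (b0^-1 * q0 `^ alpha) q0^-1)^-1)%:C * S f
    & (* (iv) *)
      forall q0 b0 : R, q = q0%:C -> b = b0%:C ->
        0 < q0 -> q0 < 1 -> q0 `^ (alpha + 1) < b0 ->
        exists S : {poly R[i]} -> R[i],
          form_series
            (fun k : nat =>
               let c := 'i%C * (Num.sqrt b0 * q0 `^ (k%:R / 2))%:C in
               scale_form
                 ((b0^-1 * q0 `^ (alpha + 1)) ^+ k / qpoch q0 q0 k)%:C
                 (scale_form 2^-1 (add_form (dirac_form c) (dirac_form (- c)))))
            S
          /\ forall f : {poly R[i]},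
               u f = (qpoch_inf (b0^-1 * q0 `^ (alpha + 1)) q0)%:C * S f].
Proof.
split.
- split; first exact: Laguerre_semiclassical hq hb0 hb hv hsym hsigma.
  exact: Laguerre_class1 hq hb0 hb hv hsym hsigma.
- move=> n; split; last exact: hsym.
  exact: Laguerre_moment hq hb0 hv hsigma n.
- move=> q0 b0 qE bE q1; have q0_gt0 : 0 < q0 by exact: lt_trans q1.
  exact: (Laguerre_weight hq hb0 hv hsym hsigma qE bE q0_gt0 q1).
- move=> q0 b0 qE bE q1; have q0_gt0 : 0 < q0 by exact: lt_trans q1.
  exact: (Laguerre_discrete_gt1 hq hb0 hv hsym hsigma qE bE q0_gt0 q1).
- move=> q0 b0 qE bE q0_gt0.
  exact: (Laguerre_discrete_lt1 hq hb0 hv hsym hsigma qE bE q0_gt0).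
Qed.
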